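(* Let $B$ be an even, unimodular, indefinite integral lattice, and let $A = B(2)\oplus U$. For an integer $n$, consider the set of primitive vectors $\omega\in A$ with $\langle \omega,\omega\rangle = 2n$. The number of orbits of this set under the action of the orthogonal group $O(A)$ is exactly $1$ if $n$ is odd, and exactly $2$ if $n$ is even.
   Context: A lattice is a free $\mathbb{Z}$-module of finite rank with a nondegenerate symmetric integral bilinear form $\langle\cdot,\cdot\rangle$. $U$ denotes the hyperbolic plane: rank $2$ with basis $u,v$, $\langle u,u\rangle=\langle v,v\rangle=0$, $\langle u,v\rangle=1$. For a lattice $L$ and nonzero integer $m$, $L(m)$ is the same $\mathbb{Z}$-module with form multiplied by $m$. A nonzero $\omega\in L$ is primitive if $\frac{1}{k}\omega\notin L$ for every integer $k\neq\pm1$. $O(L)$ is the group of isometries of $L$ onto itself. *)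

(* Defs.v *)
(* Lattices of rank r are modelled as Z^r (row vectors
   'rV[int]_r) equipped with an integral symmetric Gram matrix. *)
From HB Require Import structures.
From mathcomp Require Import all_boot all_order all_algebra.
Set Implicit Arguments. Unset Strict Implicit. Unset Printing Implicit Defensive.
Import Order.TTheory GRing.Theory Num.Theory.
Local Open Scope ring_scope.

Definition bform (r : nat) (G : 'M[int]_r) (x y : 'rV[int]_r) : int :=
  (x *m G *m y^T) 0 0.

Definition is_lattice (r : nat) (G : 'M[int]_r) : Prop :=
  G^T = G /\ \det G != 0.

Definition even_lattice (r : nat) (G : 'M[int]_r) : Prop :=
  forall x : 'rV[int]_r, (2 %| bform G x x)%Z.

Definition unimodular (r : nat) (G : 'M[int]_r) : Prop :=
  \det G = 1 \/ \det G = -1.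

(* the real quadratic form takes both signs (equivalently on integer vectors) *)
Definition indefinite (r : nat) (G : 'M[int]_r) : Prop :=
  (exists x : 'rV[int]_r, 0 < bform G x x) /\
  (exists y : 'rV[int]_r, bform G y y < 0).

Definition U_gram : 'M[int]_2 := \matrix_(i < 2, j < 2) (if i == j then 0 else 1).

Definition rescale (r : nat) (m : int) (G : 'M[int]_r) : 'M[int]_r := m *: G.

Definition osum (r s : nat) (G : 'M[int]_r) (H : 'M[int]_s) : 'M[int]_(r + s) :=
  block_mx G 0 0 H.

Definition primitive (r : nat) (v : 'rV[int]_r) : Prop :=
  v != 0 /\ forall (k : int) (w : 'rV[int]_r), v = k *: w -> k = 1 \/ k = -1.

Definition isometry (r : nat) (G : 'M[int]_r) (g : 'M[int]_r) : Prop :=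
  g \in unitmx /\ forall x y : 'rV[int]_r, bform G (x *m g) (y *m g) = bform G x y.

Definition same_orbit (r : nat) (G : 'M[int]_r) (x y : 'rV[int]_r) : Prop :=
  exists g, isometry G g /\ y = x *m g.

Definition num_classes (T : Type) (S : T -> Prop) (R : T -> T -> Prop) (k : nat) : Prop :=
  exists reps : 'I_k -> T,
    (forall i, S (reps i)) /\
    (forall i j, R (reps i) (reps j) -> i = j) /\
    (forall x, S x -> exists i, R (reps i) x).

(* Main.v *)
(* B is isotropic, because W(Z) = Z: diagonalise B over Q and stabilise by hyperbolic
   planes <a, -a>.  At each prime p the second residue form of B in W(F_p) vanishes, as B
   is unimodular; so, taking the primes in decreasing order, the Witt class can be
   rewritten without entries divisible by p, using <a, b> = <a + b, ab(a + b)>.  What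
   remains is a sum of forms <1> and <-1>; indefiniteness makes it shorter than B, and
   counting dimensions of isotropic subspaces gives an isotropic vector of B.

   B then contains e, f with (e, e) = (f, f) = 0 and (e, f) = 1.  A vector of A is a
   triple (b, x, y) of norm 2 (b, b) + 2xy.  The transvections
   (b, x, y) -> (b + xa, x, y - 2(b, a) - (a, a)x), the exchange of x and y, and the Eichler
   transvections of B allow a Euclidean descent: on |x| when x is odd, ending at
   (0, 1, n), and on |(b, e)| when x and y are even, ending at ((n/2) e + f, 0, 0).
   Which case occurs is detected by whether the vector pairs evenly with all of A. *)
Require Import Defs.
From mathcomp Require Import all_boot all_order all_algebra all_fingroup finfield.
From mathcomp Require Import zify ring lra.
Set Implicit Arguments. Unset Strict Implicit. Unset Printing Implicit Defensive.
Import Order.TTheory GRing.Theory Num.Theory.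
Local Open Scope ring_scope.

(** * Witt equivalence of diagonal forms *)

(** The isotropic vector of B is the main obstacle: in low rank the usual source is the
    Hasse-Minkowski theorem. Working in W(Q) through moves on lists of integers avoids it. One
    rational diagonalisation need not have entries prime to every p. So each odd prime gets its own
    diagonalisation with entries prime to it, and a Lagrangian argument carries the vanishing of the
    residue over to one fixed list. At 2 an even form has no diagonalisation with odd entries, but
    there the invariant only sees the parity of the valuation of the determinant, which is a square
    times 1 or -1. Witt equivalence allows hyperbolic planes on both sides. Cancelling them is only
    done for dimensions of isotropic subspaces, and this is enough. The factor 2 in B(2) shapes the
    descents: transvections preserve the parities of x and y, so Euclidean division is only
    available modulo even multiples. An odd quantity is therefore carried along, x in one case and
    (b, e) in the other; it can never become 0. A descent stalls only on divisibility, and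
    primitivity together with unimodularity of B gets it moving again. *)

(* A list of nonzero integers stands for the diagonal form over Q with these entries;
   [ceq] is generated by elementary isometries, and [weq] below is Witt equivalence. *)
Inductive ceq : seq int -> seq int -> Prop :=
| ceq_refl l : ceq l l
| ceq_sym l l' : ceq l l' -> ceq l' l
| ceq_trans l2 l1 l3 : ceq l1 l2 -> ceq l2 l3 -> ceq l1 l3
| ceq_cons a l l' : ceq l l' -> ceq (a :: l) (a :: l')
| ceq_swap a b l : ceq (a :: b :: l) (b :: a :: l)
| ceq_scale a c l : c != 0 -> ceq (a :: l) (a * c ^+ 2 :: l)
| ceq_add a b l : a != 0 -> b != 0 -> a + b != 0 ->
    ceq (a :: b :: l) (a + b :: a * b * (a + b) :: l).

Lemma ceq_catl s l l' : ceq l l' -> ceq (s ++ l) (s ++ l').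
Proof. by elim: s => //= a s IHs /IHs; apply: ceq_cons. Qed.

Lemma ceq_perm l l' : perm_eq l l' -> ceq l l'.
Proof.
move=> /catCA_perm_ind; apply; last exact: ceq_refl.
move=> s1 s2 s3 /ceq_trans; apply.
elim: s1 => [|a s1 IHs1] /=; first exact: ceq_refl.
apply: (ceq_trans (ceq_cons a IHs1)).
elim: {IHs1} s2 => [|b s2 IHs2] /=; first exact: ceq_refl.
by apply: (ceq_trans (ceq_swap _ _ _)); apply: ceq_cons.
Qed.

Ltac perm_tac :=
  apply/seq.permP=> ?; rewrite ?(count_cat, map_cat) /= ?(count_cat, map_cat) /=; clear; lia.

Lemma ceq_cat l1 l1' l2 l2' :
  ceq l1 l1' -> ceq l2 l2' -> ceq (l1 ++ l2) (l1' ++ l2').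
Proof.
move=> h1 h2; apply: (ceq_trans (ceq_catl _ h2)).
apply: (ceq_trans (ceq_perm _ : ceq _ (l2' ++ l1))); first by perm_tac.
apply: (ceq_trans (ceq_catl _ h1)); apply: ceq_perm; perm_tac.
Qed.

Lemma ceq_map_mul c l l' : c != 0 -> ceq l l' ->
  ceq [seq c * a | a <- l] [seq c * a | a <- l'].
Proof.
move=> c0; elim=> {l l'} /=.
- by move=> l; apply: ceq_refl.
- by move=> l l' _; apply: ceq_sym.
- by move=> l2 l1 l3 _ h1 _; apply: ceq_trans.
- by move=> a l l' _; apply: ceq_cons.
- by move=> a b l; apply: ceq_swap.
- by move=> a d l d0; rewrite mulrA; apply: ceq_scale.
- move=> a b l a0 b0 ab0; set m := map _ l.
  have h := @ceq_add (c * a) (c * b) m.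
  rewrite -mulrDr !mulf_eq0 !negb_or c0 a0 b0 ab0 in h.
  apply: (ceq_trans (h isT isT isT)); apply: ceq_cons.
  have -> : c * a * (c * b) * (c * (a + b)) = c * (a * b * (a + b)) * c ^+ 2 by ring.
  by apply/ceq_sym/ceq_scale.
Qed.

Definition hyperb (t : seq int) : seq int := flatten [seq [:: a; - a] | a <- t].

Definition nonzero (l : seq int) := all (fun a => a != 0) l.

Lemma nonzero_cat l l' : nonzero (l ++ l') = nonzero l && nonzero l'.
Proof. exact: all_cat. Qed.

Lemma hyperb_cat t t' : hyperb (t ++ t') = hyperb t ++ hyperb t'.
Proof. by rewrite /hyperb map_cat flatten_cat. Qed.

Definition weq (l l' : seq int) : Prop :=
  exists t t', [/\ nonzero t, nonzero t' & ceq (hyperb t ++ l) (hyperb t' ++ l')].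

Lemma weq_ceq l l' : ceq l l' -> weq l l'.
Proof. by exists [::], [::]. Qed.

Lemma weq_refl l : weq l l.
Proof. exact/weq_ceq/ceq_refl. Qed.

Lemma weq_perm l l' : perm_eq l l' -> weq l l'.
Proof. by move/ceq_perm/weq_ceq. Qed.

Lemma weq_sym l l' : weq l l' -> weq l' l.
Proof. by case=> t [t' [h h' e]]; exists t', t; split=> //; apply: ceq_sym. Qed.

Lemma weq_trans l2 l1 l3 : weq l1 l2 -> weq l2 l3 -> weq l1 l3.
Proof.
move=> [t [t' [ht ht' e]]] [s [s' [hs hs' e']]].
exists (s ++ t), (t' ++ s'); rewrite !nonzero_cat ht ht' hs hs' !hyperb_cat.
split=> //; rewrite -!catA.
apply: (ceq_trans (ceq_catl _ e)).
apply: (ceq_trans _ (ceq_catl _ e')); apply: ceq_perm; perm_tac.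
Qed.

Lemma weq_cat l1 l1' l2 l2' :
  weq l1 l1' -> weq l2 l2' -> weq (l1 ++ l2) (l1' ++ l2').
Proof.
move=> [t [t' [ht ht' e]]] [s [s' [hs hs' e']]].
exists (t ++ s), (t' ++ s'); rewrite !nonzero_cat ht ht' hs hs' !hyperb_cat.
split=> //; apply: (ceq_trans _ (ceq_trans (ceq_cat e e') _));
  apply: ceq_perm; perm_tac.
Qed.

Lemma weq_hyperb t : nonzero t -> weq (hyperb t) [::].
Proof. by exists [::], t; split; rewrite //= cats0; apply: ceq_refl. Qed.

Lemma weq_oppK l : nonzero l -> weq (l ++ [seq - a | a <- l]) [::].
Proof.
move=> nz; apply: weq_trans (weq_hyperb nz); apply: weq_perm.
apply/seq.permP=> q; rewrite count_cat.
by elim: l {nz} => //= a l <-; lia.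
Qed.

Lemma weq_map_mul c l l' : c != 0 -> weq l l' ->
  weq [seq c * a | a <- l] [seq c * a | a <- l'].
Proof.
move=> c0 [t [t' [ht ht' /(ceq_map_mul c0)]]].
have hypM s : [seq c * a | a <- hyperb s] = hyperb [seq c * a | a <- s].
  by elim: s => //= a s IHs; congr [:: _, _ & _]; [exact: mulrN|exact: IHs].
have nzM s : nonzero s -> nonzero [seq c * a | a <- s].
  by rewrite /nonzero all_map; apply: sub_all => a /= a0; rewrite mulf_neq0.
by rewrite !map_cat !hypM => h; exists [seq c * a | a <- t], [seq c * a | a <- t']; rewrite !nzM.
Qed.

(** The bound is strict: for [p] prime the entries are prime to [p], [smooth p.+1] admits [p]
    itself, and [smooth 2] leaves only 1 and -1. *)
Definition smooth (p : nat) (a : int) :=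
  (a != 0) && all (fun q => (q < p)%N) (primes `|a|).

Lemma smooth_neq0 p a : smooth p a -> a != 0.
Proof. by case/andP. Qed.

Lemma smoothM p a b : smooth p a -> smooth p b -> smooth p (a * b).
Proof.
move=> /andP[a0 ha] /andP[b0 hb]; rewrite /smooth mulf_neq0 //=.
apply/allP=> q; rewrite abszM primesM ?absz_gt0 //.
by case/orP=> [/(allP ha)|/(allP hb)].
Qed.

Lemma smoothN p a : smooth p (- a) = smooth p a.
Proof. by rewrite /smooth oppr_eq0 abszN. Qed.

Lemma smooth_small p a : a != 0 -> (`|a| < p)%N -> smooth p a.
Proof.
move=> a0 ap; rewrite /smooth a0 /=; apply/allP=> q.
rewrite mem_primes => /and3P[_ _ qa]; apply: leq_ltn_trans ap.
by apply: dvdn_leq; rewrite ?absz_gt0.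
Qed.

Lemma smooth_ndvd (p : nat) a : prime p -> smooth p a -> ~~ (p %| a)%Z.
Proof.
move=> pp /andP[a0 /allP ha]; apply/negP=> pa.
have /ha : p \in primes `|a| by rewrite mem_primes pp absz_gt0 a0.
by rewrite ltnn.
Qed.

(** * Witt classes modulo entries with small prime factors *)

Section ReductionModuloSmooth.
Variable p : nat.

(* Equality of Witt classes modulo the subgroup generated by [smooth p] entries. *)
Definition red (l l' : seq int) : Prop :=
  exists2 m, all (smooth p) m & weq l (l' ++ m).

Lemma red_weq l l' : weq l l' -> red l l'.
Proof. by exists [::]; rewrite ?cats0. Qed.

Lemma red_refl l : red l l.
Proof. exact/red_weq/weq_refl. Qed.

Lemma red_perm l l' : perm_eq l l' -> red l l'.
Proof. by move/weq_perm/red_weq. Qed.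

Lemma smooth_nonzero m : all (smooth p) m -> nonzero m.
Proof. by apply: sub_all => a /smooth_neq0. Qed.

Lemma red_sym l l' : red l l' -> red l' l.
Proof.
move=> [m hm h]; exists [seq - a | a <- m].
  by rewrite all_map; apply: sub_all hm => a /=; rewrite smoothN.
apply: weq_trans (weq_cat (weq_sym h) (weq_refl _)).
rewrite -catA -[X in weq X _]cats0; apply: weq_cat (weq_refl _) _.
exact/weq_sym/weq_oppK/smooth_nonzero.
Qed.

Lemma red_trans l2 l1 l3 : red l1 l2 -> red l2 l3 -> red l1 l3.
Proof.
move=> [m hm h] [m' hm' h']; exists (m' ++ m); first by rewrite all_cat hm hm'.
by apply: (weq_trans h); rewrite catA; apply: weq_cat (weq_refl _).
Qed.

Lemma red_cat l1 l1' l2 l2' :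
  red l1 l1' -> red l2 l2' -> red (l1 ++ l2) (l1' ++ l2').
Proof.
move=> [m hm h] [m' hm' h']; exists (m ++ m'); first by rewrite all_cat hm hm'.
apply: (weq_trans (weq_cat h h')); apply: weq_perm; perm_tac.
Qed.

Lemma red_smooth m : all (smooth p) m -> red m [::].
Proof. by exists m => //; apply: weq_refl. Qed.

Lemma red_map_mul c l l' : smooth p c -> red l l' ->
  red [seq c * a | a <- l] [seq c * a | a <- l'].
Proof.
move=> hc [m hm h]; exists [seq c * a | a <- m].
  by rewrite all_map; apply: sub_all hm => a /=; apply: smoothM.
by rewrite -map_cat; apply: weq_map_mul (smooth_neq0 hc) h.
Qed.

Lemma red_scale a c : c != 0 -> red [:: a] [:: a * c ^+ 2].
Proof. by move=> c0; apply/red_weq/weq_ceq/ceq_scale. Qed.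

Lemma red_opp a : a != 0 -> red [:: a; - a] [::].
Proof. by move=> a0; apply/red_weq/(weq_hyperb (t := [:: a])); rewrite /= a0. Qed.

Hypothesis p_prime : prime p.

(* The relation n + p k = u gives <p n> + <p^2 k> = <p u> + <n k u>. *)
Lemma red_step (n k u : int) : smooth p n -> smooth p u ->
  (k == 0) || smooth p k -> u = n + p%:Z * k -> red [:: p%:Z * u] [:: p%:Z * n].
Proof.
move=> hn hu hk e; have p0 : p%:Z != 0 by have := prime_gt0 p_prime; lia.
case/orP: hk => [/eqP k0|hk]; first by rewrite e k0 mulr0 addr0; apply: red_refl.
have h : red [:: p%:Z * n; k * p%:Z ^+ 2] [:: p%:Z * u; n * k * u * (p%:Z ^+ 2) ^+ 2].
  have -> : n * k * u * (p%:Z ^+ 2) ^+ 2 = (p%:Z * n) * (k * p%:Z ^+ 2) * (p%:Z * u) by ring.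
  have -> : p%:Z * u = p%:Z * n + k * p%:Z ^+ 2 by rewrite e; ring.
  apply/red_weq/weq_ceq/ceq_add;
    rewrite ?mulf_neq0 ?expf_neq0 ?(smooth_neq0 hn) ?(smooth_neq0 hk) //.
  have -> : p%:Z * n + k * p%:Z ^+ 2 = p%:Z * u by rewrite e; ring.
  by rewrite mulf_neq0 // (smooth_neq0 hu).
have drop a b c : c != 0 -> smooth p b -> red [:: a; b * c ^+ 2] [:: a].
  move=> c0 hb; apply: (@red_cat [:: a] [:: a] _ [::]); first exact: red_refl.
  by apply: red_trans (red_sym (red_scale _ c0)) _; apply: red_smooth; rewrite /= hb.
apply: red_trans (red_sym _) (red_trans (red_sym h) _); apply: drop => //.
  by rewrite expf_neq0.
by rewrite !smoothM.
Qed.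

(** The product of two positive numbers below [m] is below [m ^ 2]. For [m = p] this makes the carry
    [k] smooth, as [red_step] demands. *)
Lemma quotient_lt (m v q n k : int) : 0 < v -> v < m -> 0 < q -> q < m ->
  0 <= n < m -> v * q = n + m * k -> 0 <= k < m.
Proof.
move=> v0 vm q0 qm /andP[n0 nm] e; have m0 : 0 < m by lia.
have h1 : v * q < m * m by apply: ltr_pM => //; apply: ltW.
have h2 : 0 < v * q by apply: mulr_gt0.
have h3 : m * (-1) < m * k by lia.
have h4 : m * k < m * m by lia.
by move: h3 h4; rewrite !ltr_pM2l //; lia.
Qed.

(** Dividing [u] by [p] in one go could leave a quotient with large prime factors. So one prime [q]
    of [u] is treated at a time: once [u / q] is replaced by some [v] with 0 < v < p, the product
    [v * q] is below [p ^ 2], its quotient by [p] is below [p], and [red_step] applies. *)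
Lemma red_residue u : smooth p u ->
  exists v : int, [/\ 0 < v, v < p, (v = u %[mod p])%Z & red [:: p%:Z * u] [:: p%:Z * v]].
Proof.
have [m] := ubnP `|u|%N; elim: m u => // m IHm u um hu.
have [u1|u1] := leqP `|u|%N 1.
  have : u = 1 \/ u = -1 by have := smooth_neq0 hu; lia.
  case=> ue.
    by exists 1; split; rewrite ?ue //; [have := prime_gt1 p_prime; lia|exact: red_refl].
  have p1 := prime_gt1 p_prime.
  exists (p%:Z - 1); split; [lia|lia| |].
    by apply/eqP; rewrite eqz_mod_dvd ue opprK subrK.
  have h1 : smooth p (-1) by apply: smooth_small; lia.
  have h2 : smooth p (p%:Z - 1) by apply: smooth_small; lia.
  by apply: (red_step h2 hu (k := -1)); [rewrite h1|lia].
have q_pr := pdiv_prime u1; set q := pdiv `|u| in q_pr.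
have qu : (q%:Z %| u)%Z by exact: pdiv_dvd.
have qp : (q < p)%N.
  case/andP: hu => u0 /allP; apply; rewrite mem_primes q_pr absz_gt0 u0; exact: pdiv_dvd.
have q1 := prime_gt1 q_pr.
set w := (u %/ q)%Z; have uE : u = q%:Z * w by rewrite mulrC /w divzK.
have w0 : w != 0 by apply: contraTneq (smooth_neq0 hu) => w0; rewrite uE w0 mulr0 eqxx.
have hw : smooth p w.
  rewrite /smooth w0; case/andP: hu => u0 /allP hu; apply/allP=> r.
  rewrite mem_primes => /and3P[r_pr _ rw]; apply: hu.
  by rewrite mem_primes r_pr absz_gt0 u0 uE abszM dvdn_mull.
have [|v [v0 vp vw redv]] := IHm w _ hw.
  have : (`|u| = q * `|w|)%N by rewrite {1}uE abszM.
  by have : (0 < `|w|)%N by [rewrite absz_gt0]; nia.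
have hq : smooth p q by apply: smooth_small; lia.
have hv : smooth p v by apply: smooth_small; lia.
have {redv} := red_map_mul hq redv; rewrite /= => redv.
set n := (v * q %% p)%Z.
have nE : v * q = n + p%:Z * (v * q %/ p)%Z by rewrite /n {1}(divz_eq (v * q) p); ring.
have n0 : 0 <= n by apply: modz_ge0; lia.
have np : n < p by apply: ltz_pmod; lia.
have n1 : n != 0.
  by have := smooth_ndvd p_prime (smoothM hv hq); apply: contra => /eqP ne; apply/dvdz_mod0P.
have hn : smooth p n by apply: smooth_small => //; lia.
exists n; split=> //; [lia| |].
  by rewrite /n modz_mod uE (mulrC v) -[LHS]modzMmr vw modzMmr.
apply: (red_trans (l2 := [:: p%:Z * (v * q)])).
  by rewrite uE; have -> : p%:Z * (q%:Z * w) = q%:Z * (p%:Z * w) by [ring];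
    have -> : p%:Z * (v * q) = q%:Z * (p%:Z * v) by ring.
have /andP[k0 kp] : 0 <= (v * q %/ p)%Z < p by apply: quotient_lt nE => //; lia.
apply: (red_step hn (smoothM hv hq) _ nE).
have [->|k1] := eqVneq (v * q %/ p)%Z 0; rewrite //= smooth_small //.
by move: k0 kp; clear; lia.
Qed.

Lemma red_congr u u' : smooth p u -> smooth p u' -> (u = u' %[mod p])%Z ->
  red [:: p%:Z * u] [:: p%:Z * u'].
Proof.
move=> /red_residue[v [v0 vp ve rv]] /red_residue[v' [v0' vp' ve' rv']] e.
have vv : v = v'.
  have : (v %% p)%Z = (v' %% p)%Z by rewrite ve e ve'.
  by rewrite !modz_small //; lia.
by apply: red_trans rv _; rewrite vv; apply: red_sym.
Qed.

End ReductionModuloSmooth.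

(** * Squares in finite fields *)

(** Squaring has fibres of at most two elements, and the fibre of 0 has only one; that one element
    makes the inequality strict. *)
Lemma card_squares (F : finFieldType) :
  (#|F| < 2 * #|[set x ^+ 2 | x : F]|)%N.
Proof.
set S := imset _ _.
have S0 : 0 \in S by apply/imsetP; exists 0; rewrite // expr0n.
rewrite -[#|F|]sum1_card (partition_big (fun x : F => x ^+ 2) (mem S)) /=; last first.
  by move=> x _; apply: imset_f.
rewrite (bigD1 0) //= (cardsD1 0 S) S0 mulnDr muln1.
have -> : (\sum_(x : F | x ^+ 2 == 0%R) 1 = 1)%N.
  rewrite (eq_bigl (fun x => x == 0)) ?big_pred1_eq // => x.
  by rewrite expf_eq0.
set X := (X in (1 + X < _)%N); set Y := #|_|; suff : (X <= Y * 2)%N by lia.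
rewrite {}/X {}/Y.
rewrite -sum_nat_const [X in (_ <= X)%N](eq_bigl (fun s => (s \in S) && (s != 0%R))) => [|s];
  last by rewrite !inE andbC.
apply: leq_sum => s /andP[/imsetP[x _ ->] _].
rewrite sum1_card; apply: leq_trans (_ : #|[set x; - x]| <= _)%N.
  by apply: subset_leq_card; apply/subsetP=> y yx; rewrite !inE -eqf_sqr; exact: yx.
by rewrite cards2; case: (_ != _).
Qed.

(** Pigeonhole: the values of [a * x ^+ 2] and those of [c - b * y ^+ 2] each fill more than half of
    the field, so they meet. *)
Lemma sum_two_squares_repr (F : finFieldType) (a b c : F) : a != 0 -> b != 0 ->
  exists x y, a * x ^+ 2 + b * y ^+ 2 = c.
Proof.
move=> a0 b0; have := card_squares F; set S := imset _ _ => cS.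
pose A := [set a * s | s in S]; pose B := [set c - b * s | s in S].
have cA : #|A| = #|S| by apply: card_imset; apply: mulfI.
have cB : #|B| = #|S| by apply: card_imset => s t /addrI /oppr_inj /(mulfI b0).
have : A :&: B != set0.
  apply: contraTneq cS => AB; rewrite -leqNgt mul2n -addnn -{1}cA -cB.
  by rewrite -cardsUI AB cards0 addn0 max_card.
case/set0Pn=> z /setIP[/imsetP[_ /imsetP[x _ ->] ->] /imsetP[_ /imsetP[y _ ->] e]].
by exists x, y; rewrite e subrK.
Qed.

(** The nonzero squares are roots of [X^m - 1] with m = (q - 1) / 2. A nonsquare [u] among the roots
    would raise their number to that of all squares, 0 included, which exceeds [m]. *)
Lemma euler_criterion (F : finFieldType) (q : nat) (u : F) : #|F| = q -> odd q ->
  u ^+ q.-1./2 = 1 -> exists t, u = t ^+ 2.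
Proof.
move=> qE oF; set m := _./2 => um.
have F0 : (1 < q)%N by rewrite -qE; apply/card_gt1P; exists 0, 1; rewrite eq_sym oner_eq0.
have m2 : (m * 2 = q.-1)%N by rewrite /m; lia.
have := card_squares F; rewrite qE; set S := imset _ _ => cS.
have [/imsetP[t _ ->]|uS] := boolP (u \in S); first by exists t.
pose rs := u :: enum (S :\ 0).
have rsP : all (root ('X^m - 1 : {poly F})) rs.
  apply/allP=> z; rewrite inE mem_enum => /predU1P[->|].
    by rewrite rootE !hornerE um subrr.
  case/setD1P=> z0 /imsetP[x _ zE]; rewrite rootE !hornerE zE -exprM mulnC m2.
  have x0 : x != 0 by apply: contraNneq z0 => x0; rewrite zE x0 expr0n.
  rewrite subr_eq0; apply/eqP/(mulfI x0); rewrite -exprS mulr1 prednK 1?ltnW //.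
  by rewrite -qE; apply: expf_card.
have uniq_rs : uniq rs by rewrite /= enum_uniq mem_enum !inE (negPf uS) andbF.
have m0 : (0 < m)%N by lia.
have p0 : ('X^m - 1 : {poly F}) != 0 by rewrite -size_poly_eq0 size_XnsubC.
have := max_poly_roots p0 rsP uniq_rs.
have S0 : 0 \in S by apply/imsetP; exists 0; rewrite // expr0n.
rewrite size_XnsubC // /= -cardE => h; move: cS; rewrite (cardsD1 0 S) S0 /=.
by move: h; move: #|_ :\ _| => k h1 h2; exfalso; lia.
Qed.

(** * Reduction of the entries [p * u] through quadratic forms over F_p *)

Section SmoothResidues.
Variable p : nat.
Hypothesis p_prime : prime p.

Lemma Fp_intr_eq (a b : int) : (a%:~R == b%:~R :> 'F_p) = (a == b %[mod p])%Z.
Proof. by rewrite eqz_mod_dvd (dvdz_pcharf (pchar_Fp p_prime)) intrB subr_eq0. Qed.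

Lemma Fp_intr_eq0 (a : int) : (a%:~R == 0 :> 'F_p) = (p %| a)%Z.
Proof. by rewrite (dvdz_pcharf (pchar_Fp p_prime)). Qed.

Lemma Fp_lift (x : 'F_p) : exists2 n : int, 0 <= n < p & n%:~R = x.
Proof.
exists (nat_of_ord x)%:Z; last by rewrite -pmulrn natr_Zp.
have xp : (nat_of_ord x < p)%N by rewrite -[X in (_ < X)%N](Fp_cast p_prime).
by move: xp; move: (nat_of_ord x) => i; lia.
Qed.

Lemma red_congr_Fp u u' : smooth p u -> smooth p u' -> u%:~R = u'%:~R :> 'F_p ->
  red p [:: p%:Z * u] [:: p%:Z * u'].
Proof.
by move=> hu hu' /eqP; rewrite Fp_intr_eq => /eqP; apply: red_congr.
Qed.

Lemma smooth_lift (x : 'F_p) : x != 0 -> exists n : int,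
  [/\ 0 < n, n < p, smooth p n & n%:~R = x].
Proof.
move=> x0; have [n /andP[n0 np] nx] := Fp_lift x.
have n1 : n != 0 by apply: contraNneq x0 => n1; rewrite -nx n1.
by exists n; split=> //; [lia|apply: smooth_small => //; lia].
Qed.

Lemma smooth_Fp_neq0 a : smooth p a -> a%:~R != 0 :> 'F_p.
Proof. by rewrite Fp_intr_eq0; apply: smooth_ndvd. Qed.

Lemma red_congr_sqr a b (t : 'F_p) : smooth p a -> smooth p b ->
  b%:~R = a%:~R * t ^+ 2 -> red p [:: p%:Z * a] [:: p%:Z * b].
Proof.
move=> ha hb e.
have t0 : t != 0.
  by apply: contraTneq (smooth_Fp_neq0 hb) => t0; rewrite e t0 expr0n mulr0 eqxx.
have [n [n0 _ hn nt]] := smooth_lift t0.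
apply: red_trans (red_scale _ _ (smooth_neq0 hn)) _.
rewrite -mulrA; apply: red_congr_Fp => //; first by rewrite expr2 !smoothM.
by rewrite e -nt intrM rmorphXn.
Qed.

Lemma red_cancel a b (t : 'F_p) : smooth p a -> smooth p b ->
  b%:~R = - a%:~R * t ^+ 2 -> red p [:: p%:Z * a; p%:Z * b] [::].
Proof.
move=> ha hb e; have p0 : p%:Z != 0 by have := prime_gt0 p_prime; lia.
have na : smooth p (- a) by rewrite smoothN.
have h : red p [:: p%:Z * b] [:: - (p%:Z * a)].
  by rewrite -mulrN; apply: red_sym; apply: (red_congr_sqr na hb (t := t)); rewrite intrN.
apply: red_trans (red_cat (red_refl _ [:: p%:Z * a]) h) _.
by apply: red_opp; rewrite mulf_neq0 // (smooth_neq0 ha).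
Qed.

(* Every ternary form over F_p is isotropic. *)
Lemma red_ternary a b c : smooth p a -> smooth p b -> smooth p c ->
  exists2 d, smooth p d & red p [:: p%:Z * a; p%:Z * b; p%:Z * c] [:: p%:Z * d].
Proof.
move=> ha hb hc; have p0 : p%:Z != 0 by have := prime_gt0 p_prime; lia.
have a0 := smooth_Fp_neq0 ha; have b0 := smooth_Fp_neq0 hb.
have [x [y e]] := @sum_two_squares_repr _ _ _ (- c%:~R) a0 b0.
have m0 u : smooth p u -> p%:Z * u != 0 by move=> /smooth_neq0; apply: mulf_neq0.
have drop u v w (t : 'F_p) : smooth p u -> smooth p v -> smooth p w ->
    v%:~R * t ^+ 2 = - w%:~R -> red p [:: p%:Z * u; p%:Z * v; p%:Z * w] [:: p%:Z * u].
  move=> hu hv hw et; apply: (@red_cat p [:: p%:Z * u] [:: p%:Z * u] _ [::]);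
    first exact: red_refl.
  by apply: (red_cancel (t := t)) => //; rewrite mulNr et opprK.
have [x0|x0] := eqVneq x 0.
  by exists a => //; apply: (drop _ _ _ y) => //; rewrite -e x0 expr0n mulr0 add0r.
have [y0|y0] := eqVneq y 0.
  exists b => //; apply: red_trans (red_perm _ (_ : perm_eq _ [:: p%:Z * b; p%:Z * a;
    p%:Z * c])) _.
    perm_tac.
  by apply: (drop _ _ _ x) => //; rewrite -e y0 expr0n mulr0 addr0.
have [a' [a'0 a'p ha' a'E]] := smooth_lift (mulf_neq0 a0 (expf_neq0 2 x0)).
have [b' [b'0 b'p hb' b'E]] := smooth_lift (mulf_neq0 b0 (expf_neq0 2 y0)).
(* The sum [a' + b'] could be a prime above [p]. With the negative representative, [a' + b''] has
   absolute value below [p] and is smooth. *)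
pose b'' := b' - p%:Z.
have hb'' : smooth p b'' by apply: smooth_small; rewrite /b''; clear -b'0 b'p; lia.
have b''E : b''%:~R = b'%:~R :> 'F_p.
  by rewrite /b'' intrB -pmulrn (pchar_Fp_0 p_prime) subr0.
pose s := a' + b''.
have sE : s%:~R = - c%:~R :> 'F_p by rewrite /s intrD b''E a'E b'E e.
have s0 : s != 0.
  by apply: contraTneq (smooth_Fp_neq0 hc) => s0; rewrite -oppr_eq0 -sE s0 eqxx.
have hs : smooth p s by apply: smooth_small => //; rewrite /s /b''; clear -b'0 b'p a'0 a'p; lia.
exists (a' * b'' * s); first by rewrite !smoothM.
have ra : red p [:: p%:Z * a] [:: p%:Z * a'] by apply: red_congr_sqr a'E.
have rb : red p [:: p%:Z * b] [:: p%:Z * b''].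
  by apply: (@red_congr_sqr _ _ y) => //; rewrite b''E b'E.
have rab : red p [:: p%:Z * a'; p%:Z * b''] [:: p%:Z * s; p%:Z * (a' * b'' * s)].
  have sE' : p%:Z * s = p%:Z * a' + p%:Z * b'' by rewrite /s; ring.
  apply: (red_trans (l2 := [:: p%:Z * s; p%:Z * a' * (p%:Z * b'') * (p%:Z * s)])).
    rewrite sE'; apply/red_weq/weq_ceq/ceq_add; rewrite -?sE'; exact: m0.
  apply: (@red_cat p [:: p%:Z * s] [:: p%:Z * s] [:: _] [:: _]); first exact: red_refl.
  have -> : p%:Z * a' * (p%:Z * b'') * (p%:Z * s) = p%:Z * (a' * b'' * s) * p%:Z ^+ 2 by ring.
  exact/red_sym/red_scale.
apply: red_trans (red_cat ra (red_cat rb (red_refl p [:: p%:Z * c]))) _.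
apply: red_trans (red_cat rab (red_refl p [:: p%:Z * c])) _.
apply: red_trans (red_perm _ (_ : perm_eq _ [:: p%:Z * (a' * b'' * s); p%:Z * s; p%:Z * c])) _.
  perm_tac.
by apply: (drop _ _ _ 1); rewrite ?smoothM // expr1n mulr1.
Qed.

Lemma red_le2 us : all (smooth p) us -> exists vs,
  [/\ (size vs <= 2)%N, odd (size vs) = odd (size us), all (smooth p) vs &
      red p [seq p%:Z * u | u <- us] [seq p%:Z * v | v <- vs]].
Proof.
have [m] := ubnP (size us); elim: m us => // m IHm us um hus.
have [us2|] := leqP (size us) 2; first by exists us; split=> //; apply: red_refl.
case: us um hus => [|a [|b [|c us]]] //= um /and4P[ha hb hc hus] _.
have [d hd rd] := red_ternary ha hb hc.
have [||vs [vs2 vso hvs rv]] := IHm (d :: us) => //=; [lia|by rewrite hd|].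
exists vs; split=> //; first by rewrite vso /= negbK.
apply: red_trans rv; exact: (red_cat rd (red_refl p _)).
Qed.

End SmoothResidues.

(** * Residue forms *)

Section ResidueInvariant.
Variable p : nat.
Hypothesis p_prime : prime p.

Definition vodd (a : int) : bool := odd (logn p `|a|).
(** The quadratic character, with values in F_p itself. For [p = 2] the exponent is 0 and [chi] is
    constantly 1. *)
Definition chi (x : 'F_p) : 'F_p := x ^+ p.-1./2.
Definition leg (a : int) : 'F_p := chi (a %/ p%:Z ^+ logn p `|a|)%Z%:~R.

(* The class of the second residue form in W(F_p), recorded by its rank mod 2 and
   the quadratic character of its signed discriminant. *)
Definition wres (l : seq int) : bool * 'F_p :=
  foldr (fun a s => if vodd a
                    then (~~ s.1, (if s.1 then chi (-1) else 1) * leg a * s.2)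
                    else s) (false, 1) l.

Lemma chiM x y : chi (x * y) = chi x * chi y.
Proof. exact: exprMn. Qed.

Lemma chi_sqr x : x != 0 -> chi x * chi x = 1.
Proof.
move=> x0; rewrite /chi -exprD addnn.
have [p2|podd] := even_prime p_prime; first by have -> : p.-1./2 = 0%N by rewrite p2.
rewrite halfK.
have -> : odd p.-1 = false by have := prime_gt0 p_prime; lia.
rewrite subn0; apply: (mulfI x0); rewrite -exprS prednK ?prime_gt0 // mulr1.
by rewrite -[X in x ^+ X](card_Fp p_prime) expf_card.
Qed.

Lemma chiN1_sqr : chi (-1) * chi (-1) = 1.
Proof. by apply: chi_sqr; rewrite oppr_eq0 oner_eq0. Qed.

Lemma p_decomp a : a != 0 -> exists v (u : int), a = p%:Z ^+ v * u /\ ~~ (p %| u)%Z.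
Proof.
rewrite -absz_gt0 => a0; have [m pm ma] := pfactor_coprime p_prime a0.
exists (logn p `|a|), ((-1) ^+ (a < 0)%R * m%:Z); split.
  rewrite [LHS]intEsign mulrCA; congr (_ * _).
  by rewrite {1}ma PoszM mulrC; congr (_ * _); rewrite -natz natrX natz.
by rewrite dvdzE abszMsign /= -prime_coprime.
Qed.

Lemma logn_decomp v (u : int) : ~~ (p %| u)%Z -> logn p `|p%:Z ^+ v * u| = v.
Proof.
move=> pu; rewrite abszM abszX /= mulnC logn_Gauss ?pfactorK //.
by rewrite prime_coprime.
Qed.

Lemma vodd_decomp v (u : int) : ~~ (p %| u)%Z -> vodd (p%:Z ^+ v * u) = odd v.
Proof. by move=> pu; rewrite /vodd logn_decomp. Qed.

Lemma leg_decomp v (u : int) : ~~ (p %| u)%Z -> leg (p%:Z ^+ v * u) = chi u%:~R.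
Proof.
move=> pu; rewrite /leg logn_decomp // mulKz // expf_neq0 //.
by have := prime_gt0 p_prime; lia.
Qed.

Lemma prime_ndvdM (a b : int) : ~~ (p %| a)%Z -> ~~ (p %| b)%Z -> ~~ (p %| a * b)%Z.
Proof. by rewrite !dvdzE abszM /= Euclid_dvdM // negb_or => -> ->. Qed.

Lemma voddM a b : a != 0 -> b != 0 -> vodd (a * b) = vodd a (+) vodd b.
Proof. by move=> a0 b0; rewrite /vodd abszM lognM ?absz_gt0 // oddD. Qed.

Lemma legM a b : a != 0 -> b != 0 -> leg (a * b) = leg a * leg b.
Proof.
move=> /p_decomp[v [x [-> px]]] /p_decomp[w [y [-> py]]].
rewrite mulrACA -exprD !leg_decomp ?prime_ndvdM // intrM; exact: chiM.
Qed.

Lemma leg_sqr a : a != 0 -> leg a * leg a = 1.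
Proof.
move=> /p_decomp[v [x [-> px]]]; rewrite leg_decomp //; apply: chi_sqr.
by rewrite Fp_intr_eq0.
Qed.

Lemma vodd_unit a : ~~ (p %| a)%Z -> vodd a = false.
Proof. by move=> pa; rewrite -[a]mul1r -(expr0 p%:Z) vodd_decomp. Qed.

Lemma voddN a : vodd (- a) = vodd a.
Proof. by rewrite /vodd abszN. Qed.

Lemma legN a : a != 0 -> leg (- a) = chi (-1) * leg a.
Proof.
move=> /p_decomp[v [x [-> px]]]; rewrite -mulrN !leg_decomp //.
  by rewrite -chiM mulN1r intrN.
by rewrite dvdzE abszN -dvdzE.
Qed.

(* Compares the residues of <a, b> and <a + b, ab(a + b)>, cf. [ceq_add]. *)
Lemma vodd_legD a b : a != 0 -> b != 0 -> a + b != 0 ->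
  [\/ vodd (a + b) = vodd a /\ leg (a + b) = leg a,
      vodd (a + b) = vodd b /\ leg (a + b) = leg b,
      vodd a = vodd b /\ vodd (a + b) = vodd a |
      [/\ vodd a = vodd b, vodd (a + b) = ~~ vodd a & leg a * leg b = chi (-1)] ].
Proof.
move=> a0 b0.
(* When the valuations differ, the term of smaller valuation determines both the valuation of the
   sum and its leading unit modulo [p]. *)
have asym c d v w (x y : int) : c = p%:Z ^+ v * x -> d = p%:Z ^+ w * y ->
    ~~ (p %| x)%Z -> ~~ (p %| y)%Z -> (v < w)%N ->
    vodd (c + d) = vodd c /\ leg (c + d) = leg c.
  move=> -> -> px py vw; rewrite -(subnK vw) addnS -addSn addnC exprD -mulrA -mulrDr.
  have e : (x + p%:Z ^+ (w - v.+1).+1 * y)%:~R = x%:~R :> 'F_p.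
    apply/eqP; rewrite Fp_intr_eq // eqz_mod_dvd addrC addKr exprS -mulrA.
    exact: dvdz_mulr.
  have pxy : ~~ (p %| x + p%:Z ^+ (w - v.+1).+1 * y)%Z.
    by rewrite -Fp_intr_eq0 // e Fp_intr_eq0.
  by rewrite !vodd_decomp // !leg_decomp // e.
have [v [x [aE px]]] := p_decomp a0; have [w [y [bE py]]] := p_decomp b0.
have [vw|vw|vw] := ltngtP v w.
- by move=> _; constructor 1; apply: asym aE bE _ _ _.
- by move=> _; constructor 2; rewrite addrC; apply: asym bE aE _ _ _.
move: bE; rewrite -{}vw => bE ab0.
have oab : vodd a = vodd b by rewrite aE bE !vodd_decomp.
have [e|e] := eqVneq (vodd (a + b)) (vodd a); first by constructor 3.
constructor 4; split=> //; first by move: e; case: (vodd _); case: (vodd _).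
(* With equal valuations, the parity can only change if the unit parts cancel modulo [p]; then x =
   -y in F_p, which gives the value [chi (-1)]. *)
have pxy : (p %| x + y)%Z.
  by apply: contraNT e => pxy; rewrite aE bE -mulrDr !vodd_decomp.
have : (x + y)%:~R == 0 :> 'F_p by rewrite Fp_intr_eq0.
rewrite intrD addr_eq0 => /eqP xy.
rewrite aE bE !leg_decomp // xy -[- y%:~R]mulN1r chiM -mulrA chi_sqr ?mulr1 //.
by rewrite Fp_intr_eq0.
Qed.

(** The sign (-1)^(k(k-1)/2) of the discriminant changes by (-1)^k when an entry joins k others, so
    two entries always contribute [chi (-1)] times their product ([two]). For [ceq_add] there are
    three situations: [a + b] has the class of one of [a], [b], and [a * b * (a + b)] that of the
    other; or all parities agree, and the discriminants differ by a square; or one of the two pairs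
    has no residue and that of the other has signed discriminant 1. *)
Lemma wres_ceq l l' : ceq l l' -> wres l = wres l'.
Proof.
elim=> {l l'} //=.
- by move=> l1 l2 l3 _ -> _ ->.
- by move=> a l l' _ ->.
- move=> a b l; case: (vodd a); case: (vodd b); case: (wres l) => k t //=.
  by rewrite negbK; congr pair; case: k; ring.
- move=> a c l c0; have [->|a0] := eqVneq a 0; first by rewrite mul0r.
  have c20 : c ^+ 2 != 0 by rewrite expf_neq0.
  by rewrite voddM // legM // expr2 voddM // legM // leg_sqr // addbb addbF mulr1.
move=> a b l a0 b0 ab0; have m0 : a * b != 0 by rewrite mulf_neq0.
rewrite voddM // legM // voddM // legM //.
have la := leg_sqr a0; have lb := leg_sqr b0; have ls := leg_sqr ab0.
have ss := chiN1_sqr; case: (wres l) => k t.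
set s := chi (-1) in ss *.
have two (x y : 'F_p) : (if ~~ k then s else 1) * x * ((if k then s else 1) * y * t) = s *
  (x * y) * t.
  by case: k => /=; ring.
have e1 : leg a * leg b * leg a = leg b by rewrite mulrAC la mul1r.
have e2 : leg a * leg b * leg b = leg a by rewrite -mulrA lb mulr1.
have e3 x : leg (a + b) * (x * leg (a + b)) = x by rewrite mulrCA ls mulr1.
case: (vodd_legD a0 b0 ab0).
- case=> -> es; rewrite es; case: (vodd a); case: (vodd b) => //=; rewrite ?two ?e1 //.
- case=> -> es; rewrite es; case: (vodd a); case: (vodd b) => //=; rewrite ?two ?e2 //.
  by rewrite [leg b * _]mulrC.
- case=> <- ->; case: (vodd a) => //=; by rewrite !two e3.
- case=> <- ->; case: (vodd a) => //= e; rewrite ?two ?e3 e ss mul1r ?negbK //.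
Qed.

Lemma wres_cat l l' : wres l' = (false, 1) -> wres (l ++ l') = wres l.
Proof. by move=> h; rewrite /wres foldr_cat -/(wres l') h. Qed.

Lemma wres_hyperb t l : nonzero t -> wres (hyperb t ++ l) = wres l.
Proof.
elim: t => //= a t IHt /andP[a0 /IHt]; rewrite -/(hyperb t) => ->.
rewrite voddN legN //; case: (vodd a) => //=; case: (wres l) => k x /=.
rewrite negbK; congr pair.
have := leg_sqr a0; have := chiN1_sqr; set s := chi (-1) => ss la.
rewrite [LHS](_ : _ = (s * s) * (leg a * leg a) * x); first by rewrite ss la !mul1r.
by case: k => /=; ring.
Qed.

Lemma wres_weq l l' : weq l l' -> wres l = wres l'.
Proof. by case=> t [t' [ht ht' /wres_ceq]]; rewrite !wres_hyperb. Qed.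

Lemma wres_units l : all (fun a => ~~ (p %| a)%Z) l -> wres l = (false, 1).
Proof. by elim: l => //= a l IHl /andP[/vodd_unit -> /IHl]. Qed.

Lemma wres_smooth l : all (smooth p) l -> wres l = (false, 1).
Proof. by move=> h; apply/wres_units/sub_all/h => a; apply: smooth_ndvd. Qed.

Lemma smooth_decomp a : smooth p.+1 a ->
  exists2 us, all (smooth p) us & red p [:: a] [seq p%:Z * u | u <- us].
Proof.
case/andP=> a0 /allP ha; have [v [u [aE pu]]] := p_decomp a0.
have u0 : u != 0 by apply: contraNneq pu => ->; rewrite dvdz0.
have p0 : p%:Z != 0 by have := prime_gt0 p_prime; lia.
have hu : smooth p u.
  rewrite /smooth u0; apply/allP=> q; rewrite mem_primes => /and3P[qp _ qu].
  have := ha q; rewrite mem_primes qp absz_gt0 a0 ltnS leq_eqVlt /= => /(_ _)/predU1P[].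
  - by rewrite aE abszM dvdn_mull.
  - by move=> qE; move: pu; rewrite dvdzE -qE /= qu.
  - by [].
exists (if odd v then [:: u] else [::]); first by case: (odd v); rewrite //= hu.
have vE : p%:Z ^+ v = p%:Z ^+ odd v * (p%:Z ^+ v./2) ^+ 2.
  by rewrite -exprM muln2 -exprD odd_double_half.
apply: (red_trans (l2 := [:: p%:Z ^+ odd v * u])).
  rewrite aE vE mulrAC; apply/red_sym/red_scale/expf_neq0/p0.
case: (odd v) => /=; first exact: red_refl.
by rewrite mul1r; apply: red_smooth; rewrite /= hu.
Qed.

Lemma smooth_decomp_seq l : all (smooth p.+1) l ->
  exists2 us, all (smooth p) us & red p l [seq p%:Z * u | u <- us].
Proof.
elim: l => [|a l IHl] /=; first by exists [::] => //; apply: red_refl.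
case/andP=> /smooth_decomp[us hus ra] /IHl[vs hvs rl].
exists (us ++ vs); first by rewrite all_cat hus hvs.
by rewrite map_cat; apply: (@red_cat p [:: a]).
Qed.

(** The part of [l] not yet smooth reduces to at most two entries [p * a], [p * b]. Even rank
    excludes a single one, and a trivial signed discriminant says that -ab is a square modulo [p],
    so two of them cancel. *)
Theorem wres_trivial_descent l : all (smooth p.+1) l -> wres l = (false, 1) ->
  exists2 m, all (smooth p) m & weq l m.
Proof.
move=> /smooth_decomp_seq[us hus rl] wl.
have [vs [vs2 _ hvs rv]] := red_le2 p_prime hus.
have {us hus rv}rl := red_trans rl rv.
suff : red p [seq p%:Z * v | v <- vs] [::] by move/(red_trans rl); case=> m; exists m.
have p0 : p%:Z != 0 by have := prime_gt0 p_prime; lia.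
have pE u : smooth p u -> vodd (p%:Z * u) /\ leg (p%:Z * u) = chi u%:~R.
  move=> /(smooth_ndvd p_prime) pu.
  by rewrite -[p%:Z]expr1 vodd_decomp // leg_decomp.
have : wres [seq p%:Z * v | v <- vs] = (false, 1).
  by case: rl => m hm /wres_weq; rewrite wl (wres_cat _ (wres_smooth hm)) => <-.
case: vs vs2 hvs {rl} => [|a [|b [|//]]] _ /=; first by move=> _ _; apply: red_refl.
  by case/andP=> /pE[-> _] _.
case/and3P=> ha hb _; have [-> ->] := pE _ ha; have [-> ->] /= := pE _ hb.
rewrite mul1r mulr1 -!chiM => -[e].
have a0 := smooth_Fp_neq0 p_prime ha; have b0 := smooth_Fp_neq0 p_prime hb.
suff [t te] : exists t : 'F_p, - a%:~R * b%:~R = t ^+ 2.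
  apply: (@red_cancel _ p_prime a b (t / a%:~R)) => //.
  by rewrite expr_div_n -te; field.
(* At 2 the character says nothing, but a sum of two squares is a square in characteristic 2. *)
have [p2|podd] := even_prime p_prime.
  have [x [y xy]] := @sum_two_squares_repr 'F_p 1 1 (- a%:~R * b%:~R) (oner_neq0 _) (oner_neq0 _).
  exists (x + y); rewrite sqrrD -xy !mul1r -mulr_natr.
  have -> : 2%:R = 0 :> 'F_p by rewrite -{}[X in X%:R](p2 : p = 2%N); apply: pchar_Fp_0.
  by rewrite mulr0 addr0.
have [|t ->] := euler_criterion (card_Fp p_prime) podd (u := - a%:~R * b%:~R); last by exists t.
by rewrite -[- _]mulN1r; apply: e.
Qed.

End ResidueInvariant.

(** * Descent to entries 1 and -1, and the signature *)

Lemma smoothW p a : ~~ prime p -> smooth p.+1 a -> smooth p a.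
Proof.
move=> np /andP[a0 /allP ha]; rewrite /smooth a0; apply/allP=> q qa.
have := ha q qa; rewrite ltnS leq_eqVlt => /predU1P[qp|//].
by move: qa; rewrite mem_primes qp (negPf np).
Qed.

Lemma smooth2 a : smooth 2 a -> a = 1 \/ a = -1.
Proof.
case/andP=> a0 /allP ha.
have [a1|a1] := leqP `|a|%N 1; first by have := absz_gt0 a; rewrite a0; lia.
have := ha (pdiv `|a|); rewrite mem_primes pdiv_prime // absz_gt0 a0 pdiv_dvd.
by move/(_ isT); have := prime_gt1 (pdiv_prime a1); lia.
Qed.

Lemma smooth_bound (l : seq int) : nonzero l -> exists N, all (smooth N) l.
Proof.
move=> nz; exists (\sum_(a <- l) `|a|).+1; apply/allP=> a al.
apply: smooth_small; first exact: (allP nz).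
by rewrite ltnS (big_rem a al) /= leq_addr.
Qed.

(** The bound on the prime factors is lowered one step at a time. As [wres] is a Witt invariant, the
    hypothesis on [l] also holds for every intermediate list. *)
Lemma weq_smooth2 l : nonzero l -> (forall p, prime p -> wres p l = (false, 1)) ->
  exists2 m, all (smooth 2) m & weq l m.
Proof.
move=> nz wl; have [N hN] := smooth_bound nz.
have [M0 MN] : exists M, (N <= M + 2)%N by exists N; lia.
have : exists2 m, all (smooth (M0 + 2)) m & weq l m.
  exists l; last exact: weq_refl.
  apply: sub_all hN => a /andP[a0 ha]; rewrite /smooth a0.
  by apply: sub_all ha => q; lia.
elim: M0 {N hN MN} => [|M IHM] [m hm lm]; first by exists m.
apply: IHM; have [pM|npM] := boolP (prime (M + 2)); last first.
  by exists m => //; apply: sub_all hm => a; apply: smoothW.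
have := wres_weq pM lm; rewrite wl // => /esym wm.
have [m' hm' mm'] := wres_trivial_descent pM hm wm.
by exists m' => //; apply: weq_trans mm'.
Qed.

Lemma weq_nseq m : all (smooth 2) m ->
  exists s (e : int), (e = 1 \/ e = -1) /\ weq m (nseq s e).
Proof.
elim: m => [|a m IHm] /=; first by exists 0, 1; split; [left|apply: weq_refl].
case/andP=> /smooth2 a1 /IHm[s [e [e1 h]]].
have {}h : weq (a :: m) (a :: nseq s e) := weq_cat (weq_refl [:: a]) h.
have [ae|ae] := eqVneq a e; first by move: h e1; rewrite -ae => h _; exists s.+1, a.
case: s h => [|s] h; first by exists 1, a.
exists s, e; split=> //; apply: weq_trans h _.
have aE : e = - a by lia.
rewrite /= {1}aE; apply: (@weq_cat (hyperb [:: a]) [::] (nseq s e)).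
  by apply: weq_hyperb; rewrite /= andbT; lia.
exact: weq_refl.
Qed.

(** The signature of the form over the reals. *)
Definition sgsum (l : seq int) : int := \sum_(a <- l) sgz a.

Lemma sgsum_ceq l l' : ceq l l' -> sgsum l = sgsum l'.
Proof.
rewrite /sgsum; elim=> {l l'} //.
- by move=> l1 l2 l3 _ -> _ ->.
- by move=> a l l' _; rewrite !big_cons => ->.
- by move=> a b l; rewrite !big_cons addrCA.
- by move=> a c l c0; rewrite !big_cons sgzM sgzX sqr_sg c0 mulr1.
move=> a b l a0 b0 ab0; rewrite !big_cons !addrA; congr (_ + _).
rewrite !sgzM; case: (sgzP a) a0 => // ha _; case: (sgzP b) b0 => // hb _;
  case: (sgzP (a + b)) ab0 => // hab _; lia.
Qed.

Lemma sgsum_weq l l' : weq l l' -> sgsum l = sgsum l'.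
Proof.
have hyp t m : sgsum (hyperb t ++ m) = sgsum m.
  rewrite /sgsum; elim: t => //= a t IHt; rewrite !big_cons -/(hyperb t) IHt.
  by rewrite sgzN addrA subrr add0r.
by case=> t [t' [_ _ /sgsum_ceq]]; rewrite !hyp.
Qed.

Lemma sgsum_nseq s (e : int) : sgsum (nseq s e) = s%:Z * sgz e.
Proof.
rewrite /sgsum; elim: s => [|s IHs]; first by rewrite big_nil mul0r.
by rewrite big_cons IHs intS mulrDl mul1r.
Qed.

Lemma sgsum_lt (l : seq int) : has (fun a => 0 < a) l -> has (fun a => a < 0) l ->
  `|sgsum l| < (size l)%:Z.
Proof.
have le (m : seq int) : - (size m)%:Z <= sgsum m <= (size m)%:Z.
  rewrite /sgsum; elim: m => [|a m IHm]; first by rewrite big_nil.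
  rewrite big_cons /=; move: (\sum_(_ <- _) _) IHm => S IHm.
  by case: (sgzP a) => _; lia.
have lt1 (m : seq int) : has (fun a => 0 < a) m -> - sgsum m < (size m)%:Z.
  rewrite /sgsum; elim: m => //= a m IHm /orP[a0|/IHm{}IHm]; rewrite big_cons.
    have := le m; rewrite /sgsum gtr0_sgz //.
    by move: (\sum_(_ <- _) _) => S; lia.
  move: (\sum_(_ <- _) _) IHm => S IHm.
  by case: (sgzP a) => _; lia.
have lt2 (m : seq int) : has (fun a => a < 0) m -> sgsum m < (size m)%:Z.
  rewrite /sgsum; elim: m => //= a m IHm /orP[a0|/IHm{}IHm]; rewrite big_cons.
    have := le m; rewrite /sgsum ltr0_sgz //.
    by move: (\sum_(_ <- _) _) => S; lia.
  move: (\sum_(_ <- _) _) IHm => S IHm.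
  by case: (sgzP a) => _; lia.
by move=> /lt1 h1 /lt2 h2; rewrite ltr_norml; lia.
Qed.

(** * Splitting off a represented value *)

Definition qform (l : seq int) (x : nat -> int) : int :=
  \sum_(i < size l) l`_i * x i ^+ 2.

Lemma qform_cons a l x : qform (a :: l) x = a * x 0%N ^+ 2 + qform l (x \o succn).
Proof. by rewrite /qform big_ord_recl. Qed.

Lemma ceq_nonzero l l' : ceq l l' -> nonzero l = nonzero l'.
Proof.
elim=> {l l'} //=.
- by move=> l1 l2 l3 _ -> _ ->.
- by move=> a l l' _ ->.
- by move=> a b l; rewrite andbCA.
- by move=> a c l c0; rewrite mulf_eq0 expf_eq0 /= (negPf c0) orbF.
by move=> a b l a0 b0 ab0; rewrite !mulf_eq0 (negPf a0) (negPf b0) (negPf ab0).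
Qed.

(** Only elementary moves are used: the head contributes [a * y ^+ 2], the tail splits off its own
    value [t'] by induction, and [ceq_add] merges the two. If they are opposite, they already form
    the hyperbolic pair. *)
Lemma ceq_represents (l : seq int) (x : nat -> int) : nonzero l ->
  (exists2 i, (i < size l)%N & x i != 0) ->
  (qform l x != 0 -> exists l', ceq l (qform l x :: l')) /\
  (qform l x = 0 -> exists (a : int) l', ceq l (a :: - a :: l')).
Proof.
elim: l x => [|a l IHl] x; first by move=> _ [].
case/andP=> a0 nz [i il xi]; rewrite qform_cons; set t' := qform l _; set y := x 0%N.
have sc : y != 0 -> ceq (a :: l) (a * y ^+ 2 :: l) by apply: ceq_scale.
have ay : y != 0 -> a * y ^+ 2 != 0 by move=> y0; rewrite mulf_neq0 ?expf_neq0.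
have [/existsP[j xj]|/existsPn x0] := boolP [exists j : 'I_(size l), x j.+1 != 0]; last first.
  have t0 : t' = 0.
    apply: big1 => j _; have := x0 j; rewrite negbK => /eqP /= ->.
    by rewrite expr0n mulr0.
  have y0 : y != 0.
    by case: i il xi => //= i il; have := x0 (Ordinal (il : (i < size l)%N));
      rewrite negbK /= => ->.
  rewrite t0 addr0; split; first by move=> _; exists l; apply: sc.
  by move=> e; move: (ay y0); rewrite e eqxx.
have [|IHt IH0] := IHl (x \o succn) nz; first by exists j.
have swap3 b c m : ceq (a :: b :: c :: m) (b :: c :: a :: m).
  by apply: ceq_perm; perm_tac.
have [y0|y0] := eqVneq y 0.
  rewrite y0 expr0n mulr0 add0r; split.
    case/IHt=> l' h; exists (a :: l'); apply: ceq_trans (ceq_cons a h) _; exact: ceq_swap.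
  case/IH0=> b [l' h]; exists b, (a :: l'); apply: ceq_trans (ceq_cons a h) _; exact: swap3.
have [t0|t0] := eqVneq t' 0.
  rewrite t0 addr0; split; first by move=> _; exists l; apply: sc.
  by move=> e; move: (ay y0); rewrite e eqxx.
have [l' h] := IHt t0.
have {}h : ceq (a :: l) (a * y ^+ 2 :: t' :: l') := ceq_trans (sc y0) (ceq_cons _ h).
split=> e; last first.
  by exists (a * y ^+ 2), l'; rewrite (_ : - _ = t') //; lia.
exists (a * y ^+ 2 * t' * (a * y ^+ 2 + t') :: l'); apply: ceq_trans h _.
by apply: ceq_add => //; apply: ay.
Qed.

(** * Isotropic subspaces *)

(** The size is a parameter separate from [size l], so that block decompositions need no casts;
    positions beyond the list hold 0. *)
Definition dmx m (l : seq int) : 'M[rat]_m := diag_mx (\row_i (l`_i)%:~R).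

Lemma dmx_cat k m l1 l2 : size l1 = k ->
  dmx (k + m) (l1 ++ l2) = block_mx (dmx k l1) 0 0 (dmx m l2).
Proof.
move=> s1; apply/matrixP=> i j; rewrite !mxE.
case: (splitP i) => i' iE; rewrite !mxE; case: (splitP j) => j' jE; rewrite !mxE.
- by rewrite nth_cat iE s1 ltn_ord -!val_eqE /= iE jE.
- rewrite -val_eqE /= iE jE eqn_leq [(k + _ <= _)%N]leqNgt.
  by rewrite (leq_trans (ltn_ord i')) ?leq_addr // andbF mulr0n.
- rewrite -val_eqE /= iE jE eqn_leq leqNgt.
  by rewrite (leq_trans (ltn_ord j')) ?leq_addr // mulr0n.
- by rewrite nth_cat iE s1 ltnNge leq_addr addKn -!val_eqE /= iE jE eqn_add2l.
Qed.

Definition isom m (l l' : seq int) : Prop :=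
  exists2 P : 'M[rat]_m, P \in unitmx & P *m dmx m l *m P^T = dmx m l'.

Lemma isom_cat k m l1 l1' l2 l2' : size l1 = k -> size l1' = k ->
  isom k l1 l1' -> isom m l2 l2' -> isom (k + m) (l1 ++ l2) (l1' ++ l2').
Proof.
move=> s1 s1' [P Pu PE] [Q Qu QE]; exists (block_mx P 0 0 Q).
  by rewrite unitmxE det_ublock unitrM -!unitmxE Pu Qu.
rewrite !dmx_cat // tr_block_mx !mulmx_block !(mulmx0, mul0mx, addr0, add0r, trmx0).
by rewrite PE QE.
Qed.

Lemma isom_refl m l : isom m l l.
Proof. by exists 1%:M; rewrite ?unitmx1 // mul1mx trmx1 mulmx1. Qed.

Definition mx2 (a b c d : rat) : 'M[rat]_2 :=
  \matrix_(i, j) if i == 0 then (if j == 0 then a else b) else (if j == 0 then c else d).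

Lemma mx2_ext (A B : 'M[rat]_2) : A 0 0 = B 0 0 -> A 0 1 = B 0 1 ->
  A 1 0 = B 1 0 -> A 1 1 = B 1 1 -> A = B.
Proof.
move=> e1 e2 e3 e4; apply/matrixP=> i j.
have o2 (k : 'I_2) : k = 0 \/ k = 1 by case: k => [[|[]]] // h; [left|right]; apply/val_inj.
by case: (o2 i) => ->; case: (o2 j) => ->.
Qed.

Lemma mx2M a b c d a' b' c' d' : mx2 a b c d *m mx2 a' b' c' d' =
  mx2 (a * a' + b * c') (a * b' + b * d') (c * a' + d * c') (c * b' + d * d').
Proof. by apply: mx2_ext; rewrite !mxE !big_ord_recl big_ord0 !mxE /= addr0. Qed.

Lemma mx2T a b c d : (mx2 a b c d)^T = mx2 a c b d.
Proof. by apply: mx2_ext; rewrite !mxE. Qed.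

Lemma mx2_1 : 1%:M = mx2 1 0 0 1.
Proof. by apply: mx2_ext; rewrite !mxE. Qed.

Lemma dmx2 a b : dmx 2 [:: a; b] = mx2 a%:~R 0 0 b%:~R.
Proof. by apply: mx2_ext; rewrite !mxE. Qed.

Lemma size_ceq l l' : ceq l l' -> size l = size l'.
Proof. by elim=> {l l'} //= [l1 l2 l3 _ -> _ ->|a l l' _ ->]. Qed.

Lemma ceq_isom l l' : ceq l l' -> forall m, size l = m -> isom m l l'.
Proof.
elim=> {l l'}.
- by move=> l m _; apply: isom_refl.
- move=> l l' h IH m sm; have [|P Pu PE] := IH m; first by rewrite (size_ceq h).
  exists (invmx P); first by rewrite unitmx_inv.
  by rewrite -PE trmx_inv -!mulmxA mulmxV ?unitmx_tr // mulmx1 mulKmx.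
- move=> l2 l1 l3 h1 IH1 _ IH2 m sm; have [P Pu PE] := IH1 m sm.
  have [|Q Qu QE] := IH2 m; first by rewrite -(size_ceq h1).
  exists (Q *m P); first by rewrite unitmx_mul Qu Pu.
  by rewrite -QE -PE trmx_mul !mulmxA.
- move=> a l l' _ IH [|m] //= [sm].
  exact: (@isom_cat 1 m [:: a] [:: a] l l' erefl erefl (isom_refl _ _) (IH m sm)).
- move=> a b l [|[|m]] //= [sm].
  apply: (@isom_cat 2 m [:: a; b] [:: b; a] l l erefl erefl _ (isom_refl _ _)).
  exists (mx2 0 1 1 0).
    apply: (@proj1 _ _ (mulmx1_unit (_ : mx2 0 1 1 0 *m mx2 0 1 1 0 = 1%:M))).
    by rewrite mx2M mx2_1; congr mx2; ring.
  by rewrite !dmx2 mx2T !mx2M; congr mx2; ring.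
- move=> a c l c0 [|m] //= [sm].
  apply: (@isom_cat 1 m [:: a] [:: a * c ^+ 2] l l erefl erefl _ (isom_refl _ _)).
  exists (c%:~R)%:M.
    by rewrite unitmxE det_scalar1 unitfE intr_eq0.
  apply/matrixP=> i j; rewrite !ord1 tr_scalar_mx mul_scalar_mx mul_mx_scalar !mxE /= !mulr1n.
  by rewrite intrM rmorphXn /=; ring.
move=> a b l a0 b0 ab0 [|[|m]] //= [sm].
apply: (@isom_cat 2 m [:: a; b] [:: a + b; a * b * (a + b)] l l erefl erefl _ (isom_refl _ _)).
have ab0' : a%:~R + b%:~R != 0 :> rat by rewrite -intrD intr_eq0.
set x : rat := a%:~R in ab0' *; set y : rat := b%:~R in ab0' *.
(* For orthogonal e, f of norms a, b, the vectors e + f and -b e + a f are orthogonal of norms a + b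
   and ab(a + b); the determinant of this change of basis is a + b. *)
exists (mx2 1 1 (- y) x).
  apply: (@proj1 _ _ (mulmx1_unit (_ : _ *m mx2 (x / (x + y)) (- 1 / (x + y)) (y /
    (x + y)) (1 / (x + y)) = 1%:M))).
  by rewrite mx2M mx2_1; congr mx2; field.
rewrite !dmx2 mx2T !mx2M -/x -/y !(intrM, intrD) -/x -/y; congr mx2; ring.
Qed.

Definition isotropic_ge m (l : seq int) k : Prop :=
  exists j (K : 'M[rat]_(j, m)), (k <= \rank K)%N /\ K *m dmx m l *m K^T = 0.

Lemma isotropic_ge_ceq l l' m k : ceq l l' -> size l = m ->
  isotropic_ge m l k -> isotropic_ge m l' k.
Proof.
move=> h sm [j [K [rK KE]]]; have [P Pu PE] := ceq_isom h sm.
exists j, (K *m invmx P); split.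
  by rewrite mxrankMfree // row_free_unit unitmx_inv.
by rewrite -PE trmx_mul !mulmxA mulmxKV // trmx_inv mulmxK ?unitmx_tr.
Qed.

Lemma dmx_hyperb m a l :
  dmx (2 + m) (a :: - a :: l) = block_mx (mx2 a%:~R 0 0 (- a%:~R)) 0 0 (dmx m l).
Proof. by rewrite (@dmx_cat 2 m [:: a; - a]) // dmx2 intrN. Qed.

Lemma isotropic_ge_hyperb1 m a l k : isotropic_ge m l k ->
  isotropic_ge (2 + m) (a :: - a :: l) k.+1.
Proof.
move=> [j [K [rK KE]]]; pose H : 'rV[rat]_2 := const_mx 1.
exists (1 + j)%N, (block_mx H 0 0 K); split.
  rewrite rank_diag_block_mx -add1n; apply: leq_add => //.
  by rewrite lt0n mxrank_eq0; apply/eqP=> /rowP/(_ 0)/eqP; rewrite !mxE oner_eq0.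
rewrite dmx_hyperb tr_block_mx !mulmx_block !(mulmx0, mul0mx, addr0, add0r, trmx0) KE.
suff -> : H *m mx2 a%:~R 0 0 (- a%:~R) *m H^T = 0 by rewrite block_mx0.
apply/matrixP=> i i'; rewrite !ord1 !mxE !big_ord_recl big_ord0 !mxE.
by rewrite !big_ord_recl !big_ord0 !mxE /=; ring.
Qed.

(** Let z = (1, 1, 0), an isotropic vector of the plane. On the orthogonal of z, projection to the
    tail preserves the form and has kernel spanned by z. If [K] is orthogonal to z, projecting [K]
    costs at most the dimension of z. Otherwise passing to the part of [K] orthogonal to z costs one
    dimension, but then z is not in [K], as [K] is isotropic, and the projection is injective.
    Either way one dimension is lost. *)
Lemma isotropic_ge_cancel1 m a l k : a != 0 ->
  isotropic_ge (2 + m) (a :: - a :: l) k.+1 -> isotropic_ge m l k.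
Proof.
move=> a0 [j0 [K0 [rK0 KE0]]].
have [j [K [Kfree jk KE]]] : exists j (K : 'M[rat]_(j, 2 + m)),
    [/\ row_free K, (k.+1 <= j)%N & K *m dmx (2 + m) (a :: - a :: l) *m K^T = 0].
  exists (\rank K0), (row_base K0); split=> //; first exact: row_base_free.
  have /submxP[X ->] : (row_base K0 <= K0)%MS by rewrite eq_row_base.
  by rewrite trmx_mul !mulmxA -2!(mulmxA X) KE0 mulmx0 mul0mx.
move: KE; rewrite dmx_hyperb; set D := block_mx _ _ _ _ => KE.
pose H : 'rV[rat]_2 := const_mx 1.
pose z : 'rV[rat]_(2 + m) := row_mx H 0.
have a0' : a%:~R != 0 :> rat by rewrite intr_eq0.
have Dz : D *m z^T = col_mx (\col_i (if i == 0 then a%:~R else - a%:~R)) 0.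
  rewrite tr_row_mx mul_block_col !(mulmx0, mul0mx, addr0, add0r, trmx0); congr col_mx.
  apply/matrixP=> i i'; rewrite !mxE !big_ord_recl big_ord0 !mxE /=.
  by case: i => [[|[|]]] //= hi; rewrite ?mulr1 ?mul0r ?mulr0 ?addr0 ?add0r.
(* Orthogonality to z means that the two coordinates in the plane are equal. *)
have perp i (M : 'M[rat]_(i, 2 + m)) : M *m (D *m z^T) = 0 ->
    lsubmx M = col 0 (lsubmx M) *m H.
  rewrite -{1}[M]hsubmxK Dz mul_row_col mulmx0 addr0 => e.
  have e' i' : M i' (lshift m 0) = M i' (lshift m 1).
    have /matrixP/(_ i' 0) := e; rewrite !mxE !big_ord_recl big_ord0 !mxE /=.
    rewrite addr0 mulrN -mulrBl => /eqP; rewrite mulf_eq0 (negPf a0') orbF subr_eq0.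
    rewrite (_ : lift ord0 ord0 = 1); last exact/val_inj.
    by move/eqP.
  apply/matrixP=> i' j'; rewrite !mxE big_ord1 !mxE mulr1.
  have [->|->] : j' = 0 \/ j' = 1 by case: j' => [[|[]]] // h; [left|right]; apply/val_inj.
    by [].
  by rewrite -e'.
have tail i (M : 'M[rat]_(i, 2 + m)) : M *m (D *m z^T) = 0 -> M *m D *m M^T = 0 ->
    rsubmx M *m dmx m l *m (rsubmx M)^T = 0.
  move=> /perp e; rewrite -{1 2}[M]hsubmxK e tr_row_mx mul_row_block mul_row_col.
  rewrite !(mulmx0, mul0mx, addr0, add0r) trmx_mul !mulmxA -2!(mulmxA (col 0 (lsubmx M))).
  suff -> : H *m mx2 a%:~R 0 0 (- a%:~R) *m H^T = 0 by rewrite mulmx0 mul0mx add0r.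
  apply/matrixP=> i1 i2; rewrite !ord1 !mxE !big_ord_recl big_ord0 !mxE.
  by rewrite !big_ord_recl !big_ord0 !mxE /=; ring.
have [w0|w0] := eqVneq (K *m (D *m z^T)) 0.
  exists j, (rsubmx K); split; last exact: tail.
  have rj : \rank K = j by apply/eqP.
  have : (\rank K <= 1 + \rank (rsubmx K))%N.
    rewrite -{1}[K]hsubmxK -[lsubmx K]addr0 -[X in row_mx _ X]add0r -add_row_mx.
    apply: leq_trans (mxrank_add _ _) _; apply: leq_add.
      rewrite (perp _ _ w0) (_ : row_mx _ _ = col 0 (lsubmx K) *m row_mx H 0); last first.
        by rewrite mul_mx_row mulmx0.
      by apply: leq_trans (mxrankM_maxr _ _) (rank_leq_row _).
    rewrite (_ : row_mx _ _ = rsubmx K *m row_mx 0 1%:M) ?mxrankM_maxl //.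
    by rewrite mul_mx_row mulmx0 mulmx1.
  by rewrite rj; lia.
set w := K *m (D *m z^T) in w0 *.
pose K1 := kermx w *m K.
have K1z : K1 *m (D *m z^T) = 0 by rewrite -mulmxA -/w mulmx_ker.
have K1E : K1 *m D *m K1^T = 0.
  by rewrite trmx_mul !mulmxA -2!(mulmxA (kermx w)) KE mulmx0 mul0mx.
have rw : \rank w = 1%N.
  by apply/eqP; rewrite eqn_leq rank_leq_col lt0n mxrank_eq0.
have rK1 : \rank K1 = (j - 1)%N by rewrite mxrankMfree // mxrank_ker rw.
exists j, (rsubmx K1); split; last exact: tail.
have rsubE i (M : 'M[rat]_(i, 2 + m)) : M *m col_mx (0 : 'M_(2, m)) 1%:M = rsubmx M.
  by rewrite -[in LHS](hsubmxK M) mul_row_col mulmx0 mulmx1 add0r.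
rewrite -rsubE.
have := mxrank_mul_ker K1 (col_mx (0 : 'M_(2, m)) 1%:M).
suff -> : (K1 :&: kermx (col_mx (0 : 'M_(2, m)) 1%:M) = 0)%MS by rewrite mxrank0 addn0 rK1 =>
  ->; lia.
apply/eqP/rowV0P=> v; rewrite sub_capmx => /andP[vK1 /sub_kermxP vB].
have vr : rsubmx v = 0 by rewrite -rsubE.
have vz : v *m (D *m z^T) = 0.
  by case/submxP: vK1 => X ->; rewrite -mulmxA K1z mulmx0.
have vE : v = v 0 (lshift m 0) *: z.
  rewrite -[LHS]hsubmxK vr (perp _ _ vz) scale_row_mx scaler0; congr row_mx.
  by apply/rowP=> i; rewrite !mxE big_ord1 !mxE.
have vK : (v <= K)%MS by apply: submx_trans vK1 _; apply: submxMl.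
have : K *m D *m v^T = 0.
  by case/submxP: vK => X ->; rewrite trmx_mul mulmxA KE mul0mx.
rewrite vE linearZ /= -scalemxAr -mulmxA -/w => /eqP; rewrite scaler_eq0 (negPf w0) orbF.
by move/eqP => ->; rewrite scale0r.
Qed.

Lemma size_hyperb t : size (hyperb t) = (size t).*2.
Proof. by elim: t => //= a t ->. Qed.

Lemma isotropic_ge_hyperb t l :
  isotropic_ge (size (hyperb t ++ l)) (hyperb t ++ l) (size t).
Proof.
elim: t => /= [|a t IHt]; last exact: (isotropic_ge_hyperb1 (m := size (hyperb t ++ l))).
by exists 0, 0; rewrite !mul0mx.
Qed.

Lemma isotropic_ge_cancel t l k : nonzero t ->
  isotropic_ge (size (hyperb t ++ l)) (hyperb t ++ l) (size t + k) ->
  isotropic_ge (size l) l k.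
Proof.
elim: t => //= a t IHt /andP[a0 nt] h; apply: (IHt nt).
exact: (isotropic_ge_cancel1 (m := size (hyperb t ++ l)) a0 h).
Qed.

Lemma rat_row_scale n (x : 'rV[rat]_n) : exists2 d : int, d != 0 &
  exists y : 'rV[int]_n, d%:~R *: x = map_mx intr y.
Proof.
exists (\prod_i denq (x 0 i)); first by apply/prodf_neq0 => i _; rewrite denq_neq0.
exists (\row_i (\prod_(j | j != i) denq (x 0 j) * numq (x 0 i))).
apply/rowP=> i; rewrite !mxE (bigD1 i) //= !intrM mulrAC mulrC; congr (_ * _).
by rewrite -[X in _ * X]divq_num_den mulrC divfK // intr_eq0 denq_neq0.
Qed.

Lemma isotropic_ge_vector m l k : isotropic_ge m l k.+1 ->
  exists2 y : 'rV[int]_m, y != 0 &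
    map_mx intr y *m dmx m l *m (map_mx intr y)^T = 0.
Proof.
move=> [j [K [rK KE]]].
have [i Ki] : exists i, row i K != 0.
  apply/existsP; apply: contraLR rK; rewrite negb_exists => /forallP K0.
  suff -> : K = 0 by rewrite mxrank0.
  by apply/row_matrixP=> i; rewrite row0; apply/eqP; have := K0 i; rewrite negbK.
have [d d0 [y yE]] := rat_row_scale (row i K); exists y.
  apply: contraNneq Ki => y0; move: yE; rewrite y0 map_mx0 => /eqP.
  by rewrite scaler_eq0 intr_eq0 (negPf d0).
rewrite -yE linearZ /= -scalemxAl -scalemxAl -scalemxAr rowE trmx_mul !mulmxA.
by rewrite -2!(mulmxA (delta_mx _ _)) KE mulmx0 mul0mx !scaler0.
Qed.

Lemma dmx_form m (l : seq int) (x y : 'rV[rat]_m) :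
  (x *m dmx m l *m y^T) 0 0 = \sum_(i < m) (l`_i)%:~R * (x 0 i * y 0 i).
Proof.
rewrite mul_mx_diag mxE; apply: eq_bigr => i _; rewrite !mxE; ring.
Qed.

(** An isotropic vector splits off a pair [a], [- a], and [isotropic_ge_cancel1] leaves an isotropic
    subspace of half the dimension in the remaining form. *)
Lemma lagrangian_weq l k : nonzero l -> size l = k.*2 ->
  isotropic_ge (size l) l k -> weq l [::].
Proof.
elim: k l => [|k IHk] l nz sl h.
  by move/size0nil: sl => ->; apply: weq_refl.
have [y y0 yE] := isotropic_ge_vector h.
pose x i := if insub i is Some j then y 0 j else 0 : int.
have xE (j : 'I_(size l)) : x j = y 0 j by rewrite /x valK.
have [|_ [|a [l' e]]] := @ceq_represents l x nz.
- have [j yj] : exists j, y 0 j != 0 by apply/rV0Pn.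
  by exists j => //; rewrite xE.
- apply/eqP; rewrite -(intr_eq0 rat) /qform rmorph_sum /=; apply/eqP.
  have := dmx_form l (map_mx intr y) (map_mx intr y); rewrite yE mxE => e; rewrite [RHS]e.
  by apply: eq_bigr => j _; rewrite !mxE xE -!expr2 intrM rmorphXn.
have := nz; rewrite (ceq_nonzero e) => /and3P[a0 _ nz'].
have sl' : size l = (size l').+2 by rewrite (size_ceq e).
apply: (weq_trans (weq_ceq e)).
apply: weq_trans (IHk l' nz' _ _); last 2 first.
- by move: sl'; rewrite sl doubleS => -[].
- apply: (isotropic_ge_cancel1 (m := size l') a0).
  by have := isotropic_ge_ceq e erefl h; rewrite sl'.
apply: (@weq_cat [:: a; - a] [::]); last exact: weq_refl.
by apply: (@weq_hyperb [:: a]); rewrite /= a0.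
Qed.

(** * Diagonalisation at an odd prime *)

Definition idmx n (l : seq int) : 'M[int]_n := diag_mx (\row_i l`_i).

Lemma idmx_cons n a l : idmx (1 + n) (a :: l) = block_mx a%:M 0 0 (idmx n l).
Proof.
apply/matrixP=> i j; rewrite !mxE.
case: (splitP i) => i' iE; rewrite !mxE; case: (splitP j) => j' jE; rewrite !mxE;
  by rewrite -?val_eqE /= iE jE ?ord1.
Qed.

(** Some entry of the first row, in column [j], is prime to [p], as otherwise [p] would divide the
    determinant. If [p] divides both diagonal entries at 0 and [j], the sum of the two basis vectors
    has norm 2 G_0j modulo [p], a unit because [p] is odd. *)
Lemma symm_unit_value (p n : nat) (G : 'M[int]_n.+1) : prime p -> odd p -> G^T = G ->
  ~~ (p %| \det G)%Z ->
  exists2 P : 'M[int]_n.+1, ~~ (p %| \det P)%Z & ~~ (p %| (P *m G *m P^T) ord0 ord0)%Z.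
Proof.
move=> pp op Gs pG.
have pG1 : ~~ [forall j, (p %| G ord0 j)%Z].
  apply: contra pG => /forallP h; rewrite (expand_det_row _ 0).
  by apply: rpred_sum => j _; apply/dvdz_mulr.
have p1 (u : int) : u = 1 \/ u = -1 -> ~~ (p %| u)%Z.
  by have := prime_gt1 pp => p1 u1; rewrite dvdzE; case: u1 => -> /=; rewrite dvdn1; lia.
have [p00|p00] := boolP (p %| G ord0 ord0)%Z; last first.
  exists 1%:M; first by rewrite det1 p1 //; left.
  by rewrite mul1mx trmx1 mulmx1.
case/forallPn: pG1 => j pj; have j0 : j != 0 by apply: contraNneq pj => ->.
have [pjj|pjj] := boolP (p %| G j j)%Z; last first.
  exists (tperm_mx 0 j); first by rewrite det_perm p1 // odd_tperm eq_sym j0; right.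
  by rewrite tr_tperm_mx -xrowE -xcolE !mxE tpermL.
exists (1%:M + delta_mx 0 j).
  apply: p1; left; rewrite -det_tr det_trig.
    apply: big1 => i _; rewrite !mxE eqxx [_ && _](_ : _ = false) ?addr0 //.
    by apply/negbTE/negP => /andP[/eqP->]; rewrite eq_sym (negPf j0).
  apply/is_trig_mxP=> i i' ii'; rewrite !mxE [i' == i]eq_sym.
  rewrite -!val_eqE /= (ltn_eqF ii') add0r.
  by case: eqP => //= i'0; move: ii'; rewrite i'0.
have -> : ((1%:M + delta_mx 0 j) *m G *m (1%:M + delta_mx 0 j)^T) 0 0 = G 0 0 + 2 * G 0 j + G j j.
  pose v : 'rV[int]_n.+1 := delta_mx 0 0 + delta_mx 0 j.
  have rv : row 0 (1%:M + delta_mx 0 j) = v.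
    by apply/rowP=> i; rewrite !mxE eqxx [i == 0]eq_sym.
  rewrite [LHS](_ : _ = (v *m G *m v^T) 0 0).
    rewrite mulmxDl -!rowE linearD /= !trmx_delta mulmxDr -!colE !mxE.
    have -> : G j 0 = G 0 j by rewrite -[in LHS]Gs mxE.
    by ring.
  by rewrite -rv -row_mul !mxE; apply: eq_bigr => i _; rewrite !mxE.
have p2 : ~~ (p %| 2)%Z.
  by rewrite dvdzE /= dvdn_prime2 //; apply: contraTneq op => ->.
by rewrite rpredDr // rpredDl // prime_ndvdM.
Qed.

(** Gram-Schmidt over the localisation at [p], with denominators cleared: [P1] has determinant a
    power of the unit [a] instead of 1, and [G2] is the Schur complement multiplied by [a ^ 2]. *)
Lemma diagonalization (p n : nat) (G : 'M[int]_n) : prime p -> odd p -> G^T = G ->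
  ~~ (p %| \det G)%Z -> exists2 l, size l = n /\ all (fun a => ~~ (p %| a)%Z) l &
  exists P : 'M[int]_n, P *m G *m P^T = idmx n l.
Proof.
move=> pp op; elim: n G => [|n IHn] G Gs pG.
  by exists [::] => //; exists 0; apply/matrixP=> -[].
have [P pP pa] := symm_unit_value pp op Gs pG.
have [G1 G1def] : exists G1, G1 = P *m G *m P^T by exists (P *m G *m P^T).
rewrite -G1def in pa; have [a aE] : exists a, a = G1 ord0 ord0 by exists (G1 ord0 ord0).
have G1s : G1^T = G1 by rewrite G1def !trmx_mul trmxK Gs mulmxA.
have pG1 : ~~ (p %| \det G1)%Z by rewrite G1def !det_mulmx det_tr !prime_ndvdM.
pose v : 'rV_n := ursubmx (G1 : 'M_(1 + n)).
pose H : 'M_n := drsubmx (G1 : 'M_(1 + n)).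
have G1E : (G1 : 'M_(1 + n)) = block_mx a%:M v v^T H.
  apply: etrans (esym (submxK (G1 : 'M_(1 + n)))) _; congr block_mx.
    apply/matrixP=> i j; rewrite !ord1 aE !mxE /= mulr1n.
    by congr (fun_of_matrix G1 _ _); apply/val_inj.
  by rewrite /v trmx_ursub G1s.
have Hs : H^T = H by rewrite /H trmx_drsub G1s.
pose P1 : 'M[int]_(1 + n) := block_mx 1%:M 0 (- v^T) a%:M.
pose G2 : 'M[int]_n := a *: (a *: H - v^T *m v).
have P1E : P1 *m (G1 : 'M_(1 + n)) *m P1^T = block_mx a%:M 0 0 G2.
  rewrite /P1 G1E tr_block_mx !mulmx_block !tr_scalar_mx trmx0 linearN /= trmxK.
  have e : - v^T *m a%:M + a%:M *m v^T = 0.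
    by rewrite mul_scalar_mx mul_mx_scalar scalerN addNr.
  rewrite !(mulmx0, mul0mx, addr0, add0r, mul1mx, mulmx1) e mul0mx add0r.
  congr block_mx; first by rewrite mulmxN mul_scalar_mx mul_mx_scalar addNr.
  by rewrite /G2 mul_mx_scalar mul_scalar_mx mulNmx [- _ + _]addrC.
have pa' : ~~ (p %| a)%Z by rewrite aE.
have pG2 : ~~ (p %| \det G2)%Z.
  have : ~~ (p %| \det (P1 *m (G1 : 'M_(1 + n)) *m P1^T))%Z.
    rewrite !det_mulmx det_tr !prime_ndvdM //; rewrite det_lblock det1 mul1r det_scalar;
    elim: (n) => [|k IHk]; rewrite ?expr0 ?exprS ?prime_ndvdM //;
    by rewrite dvdzE /= dvdn1; have := prime_gt1 pp; lia.
  by rewrite P1E det_ublock det_scalar1; apply: contra; apply: dvdz_mull.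
have G2s : G2^T = G2.
  by rewrite /G2 linearZ /= linearB linearZ /= Hs trmx_mul trmxK.
have [l [sl pl] [Q QE]] := IHn G2 G2s pG2.
exists (a :: l); first by rewrite /= sl pa'.
have QP : block_mx 1%:M 0 0 Q *m block_mx a%:M 0 0 G2 *m (block_mx 1%:M 0 0 Q)^T
    = block_mx a%:M 0 0 (idmx n l) :> 'M_(1 + n).
  rewrite tr_block_mx !mulmx_block.
  by rewrite !(trmx0, trmx1, mulmx0, mul0mx, addr0, add0r, mul1mx, mulmx1) QE.
exists ((block_mx 1%:M 0 0 Q : 'M_(1 + n)) *m P1 *m P).
rewrite !trmx_mul !mulmxA -[_ *m P *m G]mulmxA -[_ *m (P *m G) *m P^T]mulmxA -G1def.
rewrite -[_ *m P1 *m G1]mulmxA -[_ *m (P1 *m G1) *m P1^T]mulmxA P1E.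
by rewrite idmx_cons; apply: QP.
Qed.

Lemma map_idmx n l : map_mx intr (idmx n l) = dmx n l.
Proof. by apply/matrixP=> i j; rewrite !mxE rmorphMn. Qed.

Lemma det_idmx l : \det (idmx (size l) l) = \prod_(a <- l) a.
Proof.
rewrite det_diag (big_nth 0) big_mkord; apply: eq_bigr => i _; by rewrite !mxE.
Qed.

Lemma diagonalization_unit n (G P : 'M[int]_n) l : nonzero l -> size l = n ->
  P *m G *m P^T = idmx n l ->
  map_mx intr P \in (unitmx : pred 'M[rat]_n) /\ \det P ^+ 2 * \det G = \prod_(a <- l) a.
Proof.
move=> nz sl e.
have dE : \det P ^+ 2 * \det G = \prod_(a <- l) a.
  by rewrite -det_idmx sl -e !det_mulmx det_tr; ring.
split=> //; rewrite unitmxE det_map_mx unitfE intr_eq0.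
apply: contraTneq (nz) => d0; rewrite /nonzero -has_predC; apply/hasP.
have /eqP : \prod_(a <- l) a = 0 by rewrite -dE d0 expr0n mul0r.
by rewrite prodf_seq_eq0 => /hasP[a al /= a0]; exists a; rewrite //= negbK.
Qed.

(** Both lists describe the form [G] over the rationals, so the vectors (x P^-1, x P'^-1) form an
    isotropic subspace of half the dimension in the difference of the two. *)
Lemma diagonalization_weq n (G P P' : 'M[int]_n) l l' :
  nonzero l -> nonzero l' -> size l = n -> size l' = n ->
  P *m G *m P^T = idmx n l -> P' *m G *m P'^T = idmx n l' ->
  weq (l ++ [seq - a | a <- l']) [::].
Proof.
move=> nz nz' sl sl' e e'.
have [Pu _] := diagonalization_unit nz sl e.
have [Pu' _] := diagonalization_unit nz' sl' e'.
have dE : dmx n l = map_mx intr P *m map_mx intr G *m (map_mx intr P)^T.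
  by rewrite -map_idmx -e !map_mxM map_trmx.
have dE' : dmx n l' = map_mx intr P' *m map_mx intr G *m (map_mx intr P')^T.
  by rewrite -map_idmx -e' !map_mxM map_trmx.
move: (map_mx intr P) (map_mx intr P') Pu Pu' dE dE' => Q Q' Qu Qu' dE dE'.
apply: (@lagrangian_weq _ n).
- rewrite nonzero_cat nz /nonzero all_map; apply: sub_all nz' => a /=.
  by rewrite oppr_eq0.
- by rewrite size_cat size_map sl sl' addnn.
rewrite size_cat size_map sl sl'; exists n, (row_mx (invmx Q) (invmx Q')); split.
  have {1}-> : n = \rank (row_mx (invmx Q) (invmx Q') *m col_mx Q 0).
    by rewrite mul_row_col mulmx0 addr0 mulVmx // mxrank1.
  exact: mxrankM_maxl.
rewrite dmx_cat //.
have -> : dmx n [seq - a | a <- l'] = - dmx n l'.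
  apply/matrixP=> i j; rewrite !mxE (nth_map 0) ?sl' // intrN; exact: mulNrn.
rewrite tr_row_mx mul_row_block mul_row_col !(mulmx0, addr0, add0r) dE dE'.
rewrite mulmxN mulNmx !trmx_inv !mulmxA !mulVmx // !mul1mx !mulmxK ?unitmx_tr //.
exact: subrr.
Qed.

(** At 2 the character is trivial and only the parity of the residue rank remains; it can be read
    off from the determinant. *)
Lemma wres2E l : nonzero l -> wres 2 l = (vodd 2 (\prod_(a <- l) a), 1).
Proof.
elim: l => [|a l IHl] /=; first by rewrite big_nil.
case/andP=> a0 nz; rewrite big_cons voddM //; last first.
  by rewrite prodf_seq_neq0; apply: sub_all nz => b ->.
rewrite IHl //; case: (vodd 2 a) => //=; congr pair.
by rewrite /leg /chi /= !expr0 !mulr1; case: ifP.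
Qed.

Theorem unimodular_isotropic n (G : 'M[int]_n) : G^T = G -> unimodular G -> indefinite G ->
  exists2 v : 'rV[int]_n, v != 0 & bform G v v = 0.
Proof.
move=> Gs uG [[x xG] [y yG]].
have dG (p : nat) : prime p -> ~~ (p %| \det G)%Z.
  move=> pp; have p1 := prime_gt1 pp; rewrite dvdzE.
  by case: uG => -> /=; rewrite dvdn1; lia.
have diag (p : nat) : prime p -> odd p -> exists l,
    [/\ size l = n, all (fun a => ~~ (p %| a)%Z) l, nonzero l &
        exists P : 'M[int]_n, P *m G *m P^T = idmx n l].
  move=> pp op; have [l [sl pl] PE] := diagonalization pp op Gs (dG p pp).
  by exists l; split=> //; apply: sub_all pl => a; apply: contraNneq => ->; rewrite dvdz0.
(* Any odd prime would do here: this only fixes one rational diagonalisation of [G]. *)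
have [l [sl _ nz [P PE]]] := diag 3 isT isT.
have [Pu dP] := diagonalization_unit nz sl PE.
have wl p : prime p -> wres p l = (false, 1).
  move=> pp; have [p2|op] := even_prime pp.
    have d0 : \det P != 0.
      by move: Pu; rewrite unitmxE det_map_mx unitfE intr_eq0.
    rewrite p2 wres2E // -dP voddM ?expf_neq0 //; last first.
      by case: uG => ->; rewrite ?oppr_eq0 oner_eq0.
    by rewrite expr2 voddM // addbb vodd_unit // dG.
  have [l' [sl' pl' nz' [P' PE']]] := diag p pp op.
  have /(wres_weq pp) := diagonalization_weq nz nz' sl sl' PE PE'.
  rewrite wres_cat // wres_units // all_map; apply: sub_all pl' => a /=.
  by rewrite rpredN.
have [m m2 lm] := weq_smooth2 nz wl.
have [s [e [e1 ms]]] := weq_nseq m2.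
have {m m2 lm ms} ls := weq_trans lm ms.
have dP0 : \det P != 0 by move: Pu; rewrite unitmxE det_map_mx unitfE intr_eq0.
have form (z : 'rV[int]_n) : exists w : 'rV[rat]_n,
    (bform G z z)%:~R = \sum_(i < n) (l`_i)%:~R * (w 0 i * w 0 i) :> rat.
  exists (map_mx intr z *m invmx (map_mx intr P)); rewrite -dmx_form -map_idmx -PE.
  rewrite !map_mxM -map_trmx trmx_mul trmx_inv !mulmxA mulmxKV // mulmxK ?unitmx_tr //.
  by rewrite map_trmx -!map_mxM mxE.
have hpos : has (fun a => 0 < a) l.
  apply: contraLR xG => /hasPn h; have [w wE] := form x.
  rewrite -leNgt -(ler_int rat) wE; apply: sumr_le0 => i _.
  by rewrite mulr_le0_ge0 ?ler_int0 ?sqr_ge0 // -?expr2 ?sqr_ge0 // lerz0 leNgt h // mem_nth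
    // sl.
have hneg : has (fun a => a < 0) l.
  apply: contraLR yG => /hasPn h; have [w wE] := form y.
  rewrite -leNgt -(ler_int rat) wE; apply: sumr_ge0 => i _.
  by rewrite mulr_ge0 // -?expr2 ?sqr_ge0 // ler0z leNgt h // mem_nth // sl.
(* [s] is the absolute value of the signature, and entries of both signs keep that below the
   rank. *)
have sn : (s < n)%N.
  have := sgsum_lt hpos hneg; rewrite (sgsum_weq ls) sgsum_nseq sl normrM.
  by case: e1 => ->; rewrite ?sgzN sgz1 ?normrN normr1 mulr1; lia.
case: ls => t [t' [nt nt' h]].
have sz := size_ceq h; rewrite !size_cat !size_hyperb size_nseq sl in sz.
(* Comparing lengths, 2|t| + n = 2|t'| + s with s < n, so [t'] has at least one plane more than [t].
   Cancelling those of [t] leaves an isotropic subspace of positive dimension in [l]. *)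
have [k kE] : exists k, size t' = (size t + k.+1)%N by exists (size t' - size t).-1; lia.
have := isotropic_ge_hyperb t' (nseq s e).
rewrite kE -{1}(size_ceq h) => /(isotropic_ge_ceq (ceq_sym h) (esym (size_ceq h))).
move=> /(isotropic_ge_cancel nt); rewrite sl => /isotropic_ge_vector[v v0 vE].
exists (v *m P).
  apply: contraNneq v0 => vP; have : v *m P *m \adj P = 0 by rewrite vP mul0mx.
  rewrite -mulmxA mul_mx_adj mul_mx_scalar => /rowP e0; apply/eqP/rowP=> i.
  by have /eqP := e0 i; rewrite !mxE mulf_eq0 (negPf dP0) => /eqP.
apply/eqP; rewrite /bform -(intr_eq0 rat); move: vE.
rewrite -map_idmx -PE map_trmx -!map_mxM trmx_mul !mulmxA => /matrixP/(_ 0 0).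
by rewrite [LHS]mxE [RHS]mxE => ->.
Qed.

(** * Orbits *)

Section BilinearForm.
Variables (n : nat) (G : 'M[int]_n).

Lemma bformDl x y z : bform G (x + y) z = bform G x z + bform G y z.
Proof. by rewrite /bform !mulmxDl mxE. Qed.

Lemma bformDr x y z : bform G z (x + y) = bform G z x + bform G z y.
Proof. by rewrite /bform linearD mulmxDr mxE. Qed.

Lemma bformZl a x y : bform G (a *: x) y = a * bform G x y.
Proof. by rewrite /bform -!scalemxAl mxE. Qed.

Lemma bformZr a x y : bform G x (a *: y) = a * bform G x y.
Proof. by rewrite /bform linearZ -scalemxAr mxE. Qed.

Lemma bformNl x y : bform G (- x) y = - bform G x y.
Proof. by rewrite -scaleN1r bformZl mulN1r. Qed.

Lemma bformNr x y : bform G x (- y) = - bform G x y.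
Proof. by rewrite -scaleN1r bformZr mulN1r. Qed.

Lemma bform0l y : bform G 0 y = 0.
Proof. by rewrite /bform !mul0mx mxE. Qed.

Lemma bform0r y : bform G y 0 = 0.
Proof. by rewrite /bform trmx0 mulmx0 mxE. Qed.

Definition bformE := (bformDl, bformDr, bformNl, bformNr, bformZl, bformZr, bform0l, bform0r).

Hypothesis Gs : G^T = G.

Lemma bformC x y : bform G x y = bform G y x.
Proof.
rewrite /bform; transitivity ((x *m G *m y^T)^T 0 0); first by rewrite [RHS]mxE.
by rewrite !trmx_mul trmxK Gs mulmxA.
Qed.

Lemma same_orbit_refl x : same_orbit G x x.
Proof.
exists 1%:M; split; last by rewrite mulmx1.
by split=> [|y z]; rewrite ?unitmx1 ?mulmx1.
Qed.

Lemma same_orbit_trans y x z : same_orbit G x y -> same_orbit G y z -> same_orbit G x z.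
Proof.
move=> [g [[gu gG] ->]] [h [[hu hG] ->]]; exists (g *m h); rewrite mulmxA; split=> //.
by split=> [|u v]; rewrite ?unitmx_mul ?gu ?hu // !mulmxA hG gG.
Qed.

Lemma same_orbit_sym x y : same_orbit G x y -> same_orbit G y x.
Proof.
move=> [g [[gu gG] ->]]; exists (invmx g); rewrite mulmxK //; split=> //.
by split=> [|u v]; rewrite ?unitmx_inv // -gG !mulmxKV.
Qed.

Lemma same_orbit_norm x y : same_orbit G x y -> bform G y y = bform G x x.
Proof. by move=> [g [[_ gG] ->]]. Qed.

Lemma same_orbit_primitive x y : same_orbit G x y -> primitive x -> primitive y.
Proof.
move=> [g [[gu _] ->]] [x0 xk]; split.
  by apply: contraNneq x0 => e; rewrite -(mulmxK gu x) e mul0mx.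
move=> k w e; apply: (xk k (w *m invmx g)).
by rewrite scalemxAl -e mulmxK.
Qed.

Lemma same_orbit_even x y : same_orbit G x y ->
  (forall v, (2 %| bform G x v)%Z) -> forall v, (2 %| bform G y v)%Z.
Proof.
by move=> [g [[gu gG] ->]] h v; rewrite -(mulmxKV gu v) gG.
Qed.

(** Polarisation recovers the bilinear form from the norms. No inverse of [f] has to be supplied:
    nondegeneracy forces the determinant of its matrix to have square 1. *)
Lemma same_orbit_linear (f : 'rV[int]_n -> 'rV[int]_n) x : \det G != 0 ->
  (forall k u v, f (k *: u + v) = k *: f u + f v) ->
  (forall u, bform G (f u) (f u) = bform G u u) -> same_orbit G x (f x).
Proof.
move=> dG fL fQ; pose P := \matrix_i f (delta_mx 0 i).
have f0 : f 0 = 0 by have := fL (-1) 0 0; rewrite scaler0 addr0 scaleN1r addNr.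
have fD u v : f (u + v) = f u + f v by have := fL 1 u v; rewrite !scale1r.
have fZ k u : f (k *: u) = k *: f u by have := fL k u 0; rewrite f0 !addr0.
have fE u : f u = u *m P.
  rewrite {1}[u]row_sum_delta (big_morph f fD f0) mulmx_sum_row.
  by apply: eq_bigr => i _; rewrite fZ rowK.
have PG u v : bform G (u *m P) (v *m P) = bform G u v.
  have := fQ (u + v); rewrite fD !bformE !fQ (bformC (f v)) (bformC v) -!fE; lia.
have PGP : P *m G *m P^T = G.
  apply/matrixP=> i j; have := PG (delta_mx 0 i) (delta_mx 0 j).
  rewrite /bform trmx_mul !mulmxA -(mulmxA _ P) -(mulmxA _ (P *m G)).
  by rewrite trmx_delta -!rowE -!colE !mxE.
exists P; rewrite fE; split=> //; split=> //.
have : \det P * (\det P * \det G) = 1 * \det G.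
  by rewrite mul1r -[in RHS]PGP !det_mulmx det_tr; ring.
rewrite mulrA => /(mulIf dG) d1; rewrite unitmxE.
by apply/unitrPr; exists (\det P).
Qed.

(** All coordinates of [b *m G] are divisible by [d], and [G] is invertible over the integers. *)
Lemma form_divides (d : int) b : unimodular G ->
  (forall i, (d %| bform G b (delta_mx ord0 i))%Z) -> exists b', b = d *: b'.
Proof.
move=> uG db; have Gu : G \in unitmx.
  by rewrite unitmxE; case: uG => ->; rewrite ?unitrN unitr1.
exists ((\row_i (bform G b (delta_mx ord0 i) %/ d)%Z) *m invmx G).
rewrite scalemxAl [X in X *m _](_ : _ = b *m G) ?mulmxK //.
apply/rowP=> i; rewrite !mxE mulrC divzK ?db // /bform trmx_delta -colE mxE.
by rewrite mxE.
Qed.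

End BilinearForm.

(** The Smith form of the single row [v] has one nonzero entry. The first row of the right factor is
    then the primitive direction, and the first column of its inverse is the functional with value
    1. *)
Lemma primitive_part n (v : 'rV[int]_n) : v != 0 ->
  exists d (v' u : 'rV[int]_n), v = d *: v' /\ (v' *m u^T) 0 0 = 1.
Proof.
case: n v => [|n] v v0; first by case/eqP: v0; apply/rowP => -[].
have [L Lu [R Ru [d _ vE]]] := int_Smith_normal_form v.
exists (L 0 0 * d`_0), (row 0 R), (col 0 (invmx R))^T; split.
  rewrite {1}vE [L]mx11_scalar mul_scalar_mx -scalemxAl -scalerA; congr (_ *: _).
    by rewrite mxE.
  apply/rowP=> j; rewrite !mxE (bigD1 0) //= !mxE eqxx mulr1n big1 ?addr0 // => i i0.
  by rewrite !mxE [_ == _ :> nat](_ : _ = false) ?mulr0n ?mul0r // eq_sym; apply: negbTE.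
by rewrite trmxK rowE colE !mulmxA -(mulmxA _ R) mulmxV // mulmx1 -rowE !mxE.
Qed.

(** Unimodularity turns a functional with value 1 on the primitive isotropic [e] into a vector [f];
    evenness gives (f, f) = 2k, and f - k e is isotropic. *)
Lemma hyperbolic_pair n (G : 'M[int]_n) : G^T = G -> even_lattice G -> unimodular G ->
  indefinite G -> exists e f, [/\ bform G e e = 0, bform G f f = 0 & bform G e f = 1].
Proof.
move=> Gs ev uG iG; have [v v0 vv] := unimodular_isotropic Gs uG iG.
have [d [e [u [vE eu]]]] := primitive_part v0.
have Gu : G \in unitmx by rewrite unitmxE; case: uG => ->; rewrite ?unitrN unitr1.
have d0 : d != 0 by apply: contraNneq v0 => d0; rewrite vE d0 scale0r.
have ee : bform G e e = 0.
  by apply/eqP; move/eqP: vv; rewrite vE !bformE !mulf_eq0 (negPf d0).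
pose f := u *m invmx G.
have ef : bform G e f = 1.
  by rewrite /bform trmx_mul trmx_inv Gs mulmxA mulmxK.
have /dvdzP[k fk] := ev f.
exists e, (f - k *: e); rewrite !bformE ee ef fk (bformC Gs f e) ef; split=> //; ring.
Qed.

Lemma centered_residue (a m : int) : m != 0 -> exists t, 2 * `|a + t * m| <= `|m|.
Proof.
move=> m0; have := divz_eq a m; have := modz_ge0 a m0; have := ltz_mod a m0.
set q := (a %/ m)%Z; set s := (a %% m)%Z => sm s0 aE.
have [h|h] := lerP (2 * s) `|m|.
  by exists (- q); rewrite aE (_ : _ + _ = s); [rewrite ger0_norm|ring].
exists (- q - sgz m); rewrite aE (_ : _ + _ = s - `|m|); last by rewrite [`|m|]normrEsg; ring.
rewrite ler0_norm; lia.
Qed.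

(** * Isometries of A acting on triples *)

Section Vectors.
Variables (r : nat) (G : 'M[int]_r).
Hypothesis Gs : G^T = G.
Hypothesis dG : \det G != 0.

Let A := osum (rescale 2 G) U_gram.

Definition vec (b : 'rV[int]_r) (x y : int) : 'rV[int]_(r + 2) :=
  row_mx b (\row_(i < 2) if i == 0 then x else y).

Lemma vecE w : w = vec (lsubmx w) (w 0 (rshift r 0)) (w 0 (rshift r 1)).
Proof.
rewrite -[LHS]hsubmxK; congr row_mx; apply/rowP=> i; rewrite !mxE.
have [->|->] : i = 0 \/ i = 1 by case: i => [[|[]]] // h; [left|right]; apply/val_inj.
  by [].
by [].
Qed.

Lemma vecL k b x y b' x' y' :
  k *: vec b x y + vec b' x' y' = vec (k *: b + b') (k * x + x') (k * y + y').
Proof.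
rewrite /vec scale_row_mx add_row_mx; congr row_mx; apply/rowP=> i; rewrite !mxE.
by case: ifP.
Qed.

Lemma bform_vec b x y b' x' y' :
  bform A (vec b x y) (vec b' x' y') = 2 * bform G b b' + x * y' + y * x'.
Proof.
rewrite /bform /A /osum /rescale tr_row_mx mul_row_block mul_row_col.
rewrite !(mulmx0, add0r, addr0) -scalemxAr -scalemxAl mxE [X in X + _]mxE -addrA; congr (_ + _).
rewrite !mxE !big_ord_recl big_ord0 !mxE !big_ord_recl !big_ord0 !mxE /=; ring.
Qed.

Lemma gramA_sym : A^T = A.
Proof.
rewrite /A /osum /rescale tr_block_mx !trmx0 linearZ /= Gs; congr block_mx.
by apply/matrixP=> i j; rewrite !mxE eq_sym.
Qed.

Lemma gramA_det : \det A != 0.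
Proof.
rewrite det_ublock mulf_neq0 ?detZ ?mulf_neq0 ?expf_neq0 //.
apply: contraTneq (oner_neq0 int) => d0; rewrite negbK -(det1 _ 2).
have -> : 1%:M = U_gram *m U_gram.
  apply/matrixP=> i j; rewrite !mxE !big_ord_recl big_ord0 !mxE.
  by case: i => [[|[|]]] // hi; case: j => [[|[|]]] // hj.
by rewrite det_mulmx d0 mul0r.
Qed.

(** The map is given by its three components; the second hypothesis is preservation of half the norm
    of A. *)
Lemma orbit_vec (fb : 'rV[int]_r -> int -> int -> 'rV[int]_r)
    (fx fy : 'rV[int]_r -> int -> int -> int) b x y :
  (forall k b x y b' x' y',
    [/\ fb (k *: b + b') (k * x + x') (k * y + y') = k *: fb b x y + fb b' x' y',
        fx (k *: b + b') (k * x + x') (k * y + y') = k * fx b x y + fx b' x' y' &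
        fy (k *: b + b') (k * x + x') (k * y + y') = k * fy b x y + fy b' x' y']) ->
  (forall b x y, bform G (fb b x y) (fb b x y) + fx b x y * fy b x y = bform G b b + x * y) ->
  same_orbit A (vec b x y) (vec (fb b x y) (fx b x y) (fy b x y)).
Proof.
move=> lin qu.
pose F (w : 'rV[int]_(r + 2)) := let b := lsubmx w in let x := w 0 (rshift r 0) in let y :=
  w 0 (rshift r 1) in
  vec (fb b x y) (fx b x y) (fy b x y).
have FE b' x' y' : F (vec b' x' y') = vec (fb b' x' y') (fx b' x' y') (fy b' x' y').
  by rewrite /F /= /vec row_mxKl !row_mxEr !mxE.
rewrite -FE; apply: same_orbit_linear; [exact: gramA_sym|exact: gramA_det| |].
  move=> k u v; rewrite [u]vecE [v]vecE vecL !FE vecL.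
  by have [-> -> ->] := lin k (lsubmx u) (u 0 (rshift r 0)) (u 0 (rshift r 1)) (lsubmx v)
    (v 0 (rshift r 0)) (v 0 (rshift r 1)).
move=> u; rewrite [u]vecE FE !bform_vec.
by have := qu (lsubmx u) (u 0 (rshift r 0)) (u 0 (rshift r 1)); lia.
Qed.

Lemma orbit_swap b x y : same_orbit A (vec b x y) (vec b y x).
Proof.
apply: (@orbit_vec (fun b _ _ => b) (fun _ _ y => y) (fun _ x _ => x)) => //.
by move=> *; rewrite [X in _ + X]mulrC.
Qed.

Lemma orbit_opp b x y : same_orbit A (vec b x y) (vec (- b) (- x) (- y)).
Proof.
apply: (@orbit_vec (fun b _ _ => - b) (fun _ x _ => - x) (fun _ _ y => - y)).
  by move=> *; split; rewrite ?scalerN ?opprD //; ring.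
by move=> *; rewrite !bformE; ring.
Qed.

Lemma orbit_transvection a b x y : same_orbit A (vec b x y)
  (vec (b + x *: a) x (y - 2 * bform G b a - bform G a a * x)).
Proof.
apply: (@orbit_vec (fun b x _ => b + x *: a) (fun _ x _ => x)
  (fun b x y => y - 2 * bform G b a - bform G a a * x)).
  move=> k b1 x1 y1 b2 x2 y2; split=> //.
    by rewrite scalerDr scalerDl scalerA addrACA.
  by rewrite !bformE; ring.
by move=> b1 x1 y1; rewrite !bformE (bformC Gs a b1); ring.
Qed.

Lemma orbit_transvection' a b x y : same_orbit A (vec b x y)
  (vec (b + y *: a) (x - 2 * bform G b a - bform G a a * y) y).
Proof.
apply: same_orbit_trans (orbit_swap _ _ _) _.
by apply: same_orbit_trans (orbit_transvection a _ _ _) (orbit_swap _ _ _).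
Qed.

Lemma orbit_isometry (h : 'rV[int]_r -> 'rV[int]_r) b x y :
  (forall k u v, h (k *: u + v) = k *: h u + h v) ->
  (forall u, bform G (h u) (h u) = bform G u u) ->
  same_orbit A (vec b x y) (vec (h b) x y).
Proof.
move=> hL hQ.
apply: (@orbit_vec (fun b _ _ => h b) (fun _ x _ => x) (fun _ _ y => y)).
  by move=> *; rewrite hL.
by move=> *; rewrite hQ.
Qed.

(* The Eichler transvection of B attached to an isotropic e and a orthogonal to it. *)
Lemma orbit_eichler e a k b x y :
  bform G e e = 0 -> bform G e a = 0 -> bform G a a = k * 2 ->
  same_orbit A (vec b x y)
    (vec (b + bform G b e *: a - (bform G b a + k * bform G b e) *: e) x y).
Proof.
move=> ee ea aa.
apply: (@orbit_isometry (fun b => b + bform G b e *: a - (bform G b a + k * bform G b e) *: e)).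
  move=> j u v; rewrite !bformE; apply/rowP=> i; rewrite !mxE; ring.
move=> u; rewrite !bformE !(bformC Gs e u) !(bformC Gs a u) (bformC Gs a e) ee ea aa; ring.
Qed.

Lemma orbit_reflection c b x y : bform G c c = - 2 ->
  same_orbit A (vec b x y) (vec (b + bform G b c *: c) x y).
Proof.
move=> cc; apply: (@orbit_isometry (fun b => b + bform G b c *: c)).
  move=> j u v; rewrite !bformE; apply/rowP=> i; rewrite !mxE; ring.
move=> u; rewrite !bformE !(bformC Gs c u) cc; ring.
Qed.

End Vectors.

(** * Euclidean descents *)

Section Orbits.
Variables (r : nat) (G : 'M[int]_r) (e f : 'rV[int]_r).
Hypotheses (Gs : G^T = G) (Gev : even_lattice G) (Gu : unimodular G).
Hypotheses (ee : bform G e e = 0) (ff : bform G f f = 0) (ef : bform G e f = 1).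

Let dG : \det G != 0.
Proof. by case: Gu => ->; rewrite ?oppr_eq0 oner_eq0. Qed.

Let A := osum (rescale 2 G) U_gram.
Let fe : bform G f e = 1. Proof. by rewrite bformC. Qed.

(** Orthogonal projection to the complement of the hyperbolic plane spanned by [e] and [f]. *)
Definition proj a := a - bform G a f *: e - bform G a e *: f.

Lemma proj_e a : bform G (proj a) e = 0.
Proof. by rewrite /proj !bformE ee fe; ring. Qed.

Lemma proj_f a : bform G (proj a) f = 0.
Proof. by rewrite /proj !bformE ff ef; ring. Qed.

Lemma projE a b : bform G b a = bform G a f * bform G b e + bform G a e * bform G b f + bform
  G b (proj a).
Proof. by rewrite /proj !bformE; ring. Qed.

Lemma even_half a : exists k, bform G a a = k * 2.
Proof. by apply/dvdzP; apply: Gev. Qed.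

Lemma primitive_dvd (d : int) b x y : primitive (vec b x y) -> (d %| x)%Z -> (d %| y)%Z ->
  (forall i, (d %| bform G b (delta_mx ord0 i))%Z) -> d = 1 \/ d = -1.
Proof.
move=> [_ pr] /dvdzP[x' xE] /dvdzP[y' yE] /(form_divides Gu)[b' bE].
apply: (pr d (vec b' x' y')).
rewrite -[RHS]addr0 (_ : 0 = vec 0 0 0).
  by rewrite vecL !addr0 bE xE yE ![d * _]mulrC.
rewrite /vec (_ : \row_i _ = 0) ?row_mx0 //.
by apply/rowP=> i; rewrite !mxE; case: ifP.
Qed.

(** A transvection along [f'] brings q = (b, e') to at most |x| / 2 in absolute value, and one along
    [e'] then reduces x modulo 2q, to at most |q|. The non-divisibility keeps q nonzero, and x stays
    odd because it moves by multiples of 2q. *)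
Lemma odd_descent b x y e' f' : ~~ (2 %| x)%Z -> bform G e' e' = 0 -> bform G e' f' = 1 ->
  ~~ (x %| bform G b e')%Z -> exists b2 x2 y2,
    [/\ same_orbit A (vec b x y) (vec b2 x2 y2), ~~ (2 %| x2)%Z & `|x2| < `|x|].
Proof.
move=> ox ee' ef' xq; have x0 : x != 0 by apply: contraNneq ox => ->.
have [t tq] := centered_residue (bform G b e') x0.
have o1 := orbit_transvection Gs dG (t *: f') b x y.
set b1 := b + _ in o1; set y1 := _ - _ in o1.
have q1E : bform G b1 e' = bform G b e' + t * x.
  by rewrite /b1 !bformE (bformC Gs f') ef'; ring.
set q1 := bform G b1 e' in q1E; rewrite -q1E in tq.
have q10 : q1 != 0.
  by apply: contraNneq xq => q10; apply/dvdzP; exists (- t); move: q1E; rewrite q10; lia.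
have m0 : -2 * q1 != 0 by lia.
have [s sx] := centered_residue x m0.
have o2 := orbit_transvection' Gs dG (s *: e') b1 x y1.
have := same_orbit_trans o1 o2; set x2 := x - 2 * _ - _; set b2 := _ + _ => o.
have x2E : x2 = x + s * (-2 * q1) by rewrite /x2 !bformZr bformZl ee' -/q1; ring.
exists b2, x2, y1; split=> //; first by rewrite x2E; lia.
by rewrite -x2E in sx; lia.
Qed.

Lemma orbit_odd n b x y : ~~ (2 %| x)%Z -> primitive (vec b x y) ->
  bform A (vec b x y) (vec b x y) = 2 * n -> same_orbit A (vec b x y) (vec 0 1 n).
Proof.
have [m] := ubnP `|x|%N; elim: m b x y => // m IHm b x y xm ox pr nm.
have x0 : x != 0 by apply: contraNneq ox => ->.
have [x1|x1] := leqP `|x|%N 1.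
  have [xE|xE] : x = 1 \/ x = -1 by lia.
  - rewrite xE in nm *; have o := orbit_transvection Gs dG (- b) b 1 y.
    move: o; rewrite scale1r subrr; move: (y - _ - _) => y' o.
    have nE := same_orbit_norm o; move: nE; rewrite nm bform_vec bform0l => nE.
    by rewrite (_ : n = y') //; lia.
  - rewrite xE in nm *.
    have o := same_orbit_trans (orbit_opp Gs dG b (-1) y) (orbit_transvection Gs dG b (- b)
      (- - 1) (- y)).
    move: o; rewrite opprK scale1r addNr; move: (- y - _ - _) => y' o.
    have nE := same_orbit_norm o; move: nE; rewrite nm bform_vec bform0l => nE.
    by rewrite (_ : n = y') //; lia.
have descend b' y' e' f' : same_orbit A (vec b x y) (vec b' x y') ->
    bform G e' e' = 0 -> bform G e' f' = 1 -> ~~ (x %| bform G b' e')%Z ->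
    same_orbit A (vec b x y) (vec 0 1 n).
  move=> o ee' ef' xq; have [b2 [x2 [y2 [o2 ox2 lt2]]]] := odd_descent y' ox ee' ef' xq.
  have o' := same_orbit_trans o o2.
  apply: (same_orbit_trans o'); apply: IHm => //.
  - by apply: leq_trans (_ : `|x| <= m)%N; lia.
  - exact: same_orbit_primitive o' pr.
  - by rewrite (same_orbit_norm o').
have o0 := same_orbit_refl A (vec b x y).
have [xe|xe] := boolP (x %| bform G b e)%Z; last exact: descend o0 ee ef xe.
have [xf|xf] := boolP (x %| bform G b f)%Z; last exact: descend o0 ff fe xf.
have [/forallP xd|/forallPn[i xi]] := boolP [forall i, (x %| bform G b (delta_mx ord0 i))%Z];
  last first.
  set d := delta_mx _ _ in xi; have [k kE] := even_half (proj d).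
  (* The term [- k *: e] makes f + proj d isotropic again without changing its pairing 1 with [e];
     the pairing of [b] with it differs from (b, proj d) by multiples of [x]. *)
  apply: (descend b y (f + proj d - k *: e) e) => //.
  - move: (proj_e d) (proj_f d) kE; move: (proj d) => c ce cf cc.
    rewrite !bformE ee ff ef fe (bformC Gs e c) (bformC Gs f c) ce cf cc; ring.
  - move: (proj_e d); move: (proj d) => c ce.
    by rewrite !bformE ee fe ce; ring.
  - apply: contra xi; rewrite (projE d) bformDr bformDr bformNr bformZr.
    move: (bform G b (proj d)) => u h.
    have hu : (x %| u)%Z.
      rewrite (_ : u = (bform G b f + u - k * bform G b e) - bform G b f + k * bform G b e);
        last by ring.
      exact: rpredD (rpredB h xf) (dvdz_mull _ xe).
    by rewrite !rpredD ?dvdz_mull.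
have [b' bE] := form_divides Gu xd.
have o1 := orbit_transvection Gs dG (- b') b x y.
move: o1; rewrite scalerN -bE subrr; move: (y - _ - _) => y' o1.
(* Now [b] is 0, and a transvection along [f] creates y' f, whose pairing with [e] is y'. By
   primitivity [x] cannot divide y'. *)
have o2 := orbit_transvection' Gs dG f 0 x y'.
have := same_orbit_trans o1 o2; rewrite add0r bform0l ff mulr0 mul0r !subr0 => o.
apply: (descend _ _ _ _ o ee ef); rewrite bformZl fe mulr1.
apply/negP=> xy'; have pr1 := same_orbit_primitive o1 pr.
have := primitive_dvd pr1 (dvdzz x) xy' _.
case=> [i|xE|xE]; [by rewrite bform0l dvdz0|by rewrite xE in x1|by rewrite xE in x1].
Qed.

(** The roles are exchanged: multiples of [e] reduce y modulo q = (b, e) without changing q, and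
    multiples of [f] then reduce q modulo 2y. The non-divisibility keeps y nonzero, and q stays
    odd. *)
Lemma even_descent b x y : ~~ (2 %| bform G b e)%Z -> ~~ (bform G b e %| y)%Z ->
  exists b2 x2 y2, [/\ same_orbit A (vec b (2 * x) (2 * y)) (vec b2 (2 * x2) (2 * y2)),
    ~~ (2 %| bform G b2 e)%Z & `|bform G b2 e| < `|bform G b e|].
Proof.
set q := bform G b e => oq qy; have q0 : q != 0 by apply: contraNneq oq => ->.
have [t ty] := centered_residue y q0.
have o1 := orbit_transvection Gs dG (- t *: e) b (2 * x) (2 * y).
set b1 := b + _ in o1.
have q1E : bform G b1 e = q by rewrite /b1 bformDl !bformZl ee /q; ring.
set y1 := y + t * q in ty.
have y1E : 2 * y - 2 * bform G b (- t *: e) - bform G (- t *: e) (- t *: e) * (2 * x) = 2 * y1.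
  by rewrite !bformZr !bformZl ee -/q /y1; ring.
rewrite y1E in o1.
have y10 : 2 * y1 != 0.
  suff : y1 != 0 by lia.
  by apply: contraNneq qy => y10; apply/dvdzP; exists (- t); move: y10; rewrite /y1; lia.
have [s sq] := centered_residue q y10.
have o2 := orbit_transvection' Gs dG (s *: f) b1 (2 * x) (2 * y1).
have := same_orbit_trans o1 o2; set b2 := b1 + _ => o.
have q2E : bform G b2 e = q + s * (2 * y1) by rewrite /b2 bformDl !bformZl q1E fe; ring.
exists b2, (x - bform G b1 (s *: f)), y1; split.
- rewrite (_ : 2 * (x - _) = 2 * x - 2 * bform G b1 (s *: f) - bform G (s *: f) (s *: f) *
  (2 * y1)) //.
  by rewrite !bformZr !bformZl ff; ring.
- by rewrite q2E; move: oq; clear; lia.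
- by rewrite q2E; move: oq ty sq; clear; lia.
Qed.

(** Since (b, e) = 1, transvections along [e] clear the last two coordinates, and the Eichler
    transvection by [- proj b1] removes the part of [b1] orthogonal to the plane. The coefficient of
    [e] is then dictated by the norm. *)
Lemma orbit_even_normalize n b x y : bform G b e = 1 ->
  bform A (vec b (2 * x) (2 * y)) (vec b (2 * x) (2 * y)) = 2 * (2 * n) ->
  same_orbit A (vec b (2 * x) (2 * y)) (vec (n *: e + f) 0 0).
Proof.
move=> q1 nm.
have o1 := orbit_transvection Gs dG (y *: e) b (2 * x) (2 * y).
move: o1; set b1 := b + _; rewrite bformZr q1 bformZl bformZr ee.
rewrite (_ : 2 * y - 2 * (y * 1) - y * (y * 0) * (2 * x) = 0) => [o1|]; last by ring.
have b1e : bform G b1 e = 1 by rewrite /b1 bformDl !bformZl ee q1; ring.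
have o2 := orbit_transvection' Gs dG (x *: e) b1 (2 * x) 0.
move: o2; rewrite scale0r addr0 mulr0 subr0 bformZr b1e.
rewrite (_ : 2 * x - 2 * (x * 1) = 0) => [o2|]; last by ring.
have o12 := same_orbit_trans o1 o2.
have [k kE] := even_half (- proj b1).
have pe : bform G e (- proj b1) = 0 by rewrite bformNr bformC // proj_e oppr0.
have o3 := orbit_eichler Gs dG b1 0 0 ee pe kE.
have o := same_orbit_trans o12 o3; move: o; rewrite b1e scale1r.
move: (_ + k * 1) => c; set b3 := b1 + _ - _ => o.
have [t b3E] : exists t, b3 = t *: e + f.
  exists (bform G b1 f - c); rewrite /b3 /proj b1e; apply/rowP=> i; rewrite !mxE; ring.
have := same_orbit_norm o; rewrite nm b3E bform_vec => nE.
rewrite (_ : n = t); first by rewrite -b3E.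
move: nE; rewrite bformDl !bformDr !bformZl !bformZr ee ff ef fe; lia.
Qed.

Lemma orbit_even_aux n b x y : ~~ (2 %| bform G b e)%Z ->
  primitive (vec b (2 * x) (2 * y)) ->
  bform A (vec b (2 * x) (2 * y)) (vec b (2 * x) (2 * y)) = 2 * (2 * n) ->
  same_orbit A (vec b (2 * x) (2 * y)) (vec (n *: e + f) 0 0).
Proof.
have [m] := ubnP `|bform G b e|%N; elim: m b x y => // m IHm b x y qm oq pr nm.
have [q1|q1] := leqP `|bform G b e|%N 1.
  have [qE|qE] : bform G b e = 1 \/ bform G b e = -1 by move: oq q1; clear; lia.
    exact: orbit_even_normalize.
  have o := orbit_opp Gs dG b (2 * x) (2 * y); rewrite -!mulrN in o.
  apply: (same_orbit_trans o); apply: orbit_even_normalize; first by rewrite bformNl qE opprK.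
  by rewrite (same_orbit_norm o).
have descend b' x' y' : same_orbit A (vec b (2 * x) (2 * y)) (vec b' (2 * x') (2 * y')) ->
    bform G b' e = bform G b e -> ~~ ((bform G b e %| x') && (bform G b e %| y'))%Z ->
    same_orbit A (vec b (2 * x) (2 * y)) (vec (n *: e + f) 0 0).
  wlog qy : x' y' / ~~ (bform G b e %| y')%Z => [hw o qE|o qE _].
    rewrite negb_and => /orP[qx|qy].
      apply: (hw y' x') => //; last by rewrite negb_and qx orbT.
      by apply: same_orbit_trans o (orbit_swap Gs dG _ _ _).
    by apply: (hw x' y') => //; rewrite negb_and qy orbT.
  rewrite -qE in qy; rewrite -qE in oq qm.
  have [b2 [x2 [y2 [o2 oq2 lt2]]]] := even_descent x' oq qy.
  have o' := same_orbit_trans o o2.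
  apply: (same_orbit_trans o'); apply: IHm => //.
  - by move: lt2 qm; clear; lia.
  - exact: same_orbit_primitive o' pr.
  - by rewrite (same_orbit_norm o').
have [/andP[]|qxy] := boolP ((bform G b e %| x) && (bform G b e %| y))%Z; last first.
  by apply: descend qxy => //; apply: same_orbit_refl.
set q := bform G b e in descend oq qm q1 *.
move=> /dvdzP[x1 xE] /dvdzP[y1 yE].
have [b1 o1 b1e] : exists2 b1, same_orbit A (vec b (2 * x) (2 * y)) (vec b1 (2 * 0)
  (2 * 0)) & bform G b1 e = q.
  have o1 := orbit_transvection Gs dG (y1 *: e) b (2 * x) (2 * y).
  move: o1; set b1 := b + _; rewrite bformZr -/q bformZl bformZr ee.
  rewrite (_ : 2 * y - 2 * (y1 * q) - y1 * (y1 * 0) * (2 * x) = 0) => [o1|];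
    last by rewrite yE; ring.
  have b1e : bform G b1 e = q by rewrite /b1 bformDl !bformZl ee -/q; ring.
  have o2 := orbit_transvection' Gs dG (x1 *: e) b1 (2 * x) 0.
  move: o2; rewrite scale0r addr0 mulr0 subr0 bformZr b1e.
  rewrite (_ : 2 * x - 2 * (x1 * q) = 0) => [o2|]; last by rewrite xE; ring.
  by exists b1 => //; rewrite mulr0; apply: same_orbit_trans o1 o2.
have descend_f b2 : same_orbit A (vec b (2 * x) (2 * y)) (vec b2 (2 * 0) (2 * 0)) ->
    bform G b2 e = q -> ~~ (q %| bform G b2 f)%Z ->
    same_orbit A (vec b (2 * x) (2 * y)) (vec (n *: e + f) 0 0).
  (* With both last coordinates 0, a transvection along [f] fixes b2 and writes -2 (b2, f) into the
     first of them, where the descent can use it. *)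
  move=> o b2e qp; apply: (descend b2 (- bform G b2 f) 0) => //;
    last by rewrite rpredN (negPf qp).
  apply: (same_orbit_trans o).
  have := orbit_transvection' Gs dG f b2 (2 * 0) (2 * 0).
  by rewrite !mulr0 scale0r addr0 subr0 sub0r mulrN.
have [qp|qp] := boolP (q %| bform G b1 f)%Z; last exact: descend_f o1 b1e qp.
have [/forallP qd|/forallPn[i qi]] := boolP [forall i, (q %| bform G b1 (delta_mx ord0 i))%Z].
  have pr1 := same_orbit_primitive o1 pr.
  have := primitive_dvd pr1 (dvdz0 _) (dvdz0 _) qd.
  by move: q1; clear; lia.
set d := delta_mx _ _ in qi; have [k kE] := even_half (proj d).
have pe : bform G e (proj d) = 0 by rewrite bformC // proj_e.
(* This transvection keeps the pairing with [e] and subtracts (b1, proj d) + kq from the pairing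
   with [f], which is then no longer divisible by q. *)
have o2 := orbit_eichler Gs dG b1 (2 * 0) (2 * 0) ee pe kE.
have o := same_orbit_trans o1 o2.
apply: (descend_f _ o).
  by rewrite bformDl bformDl bformNl !bformZl proj_e ee b1e; ring.
rewrite bformDl bformDl bformNl !bformZl proj_f ef b1e mulr0 addr0 mulr1.
apply: contra qi => h; rewrite (projE d) b1e.
move: (bform G b1 (proj d)) h => u h.
have hu : (q %| u)%Z.
  rewrite (_ : u = bform G b1 f - (bform G b1 f - (u + k * q)) - k * q); last by ring.
  by apply: rpredB (dvdz_mull _ (dvdzz _)); apply: rpredB.
by rewrite !rpredD ?dvdz_mull.
Qed.

(** It remains to make (b, e) odd. By primitivity [b] is not divisible by 2, so it pairs oddly with
    something: if with [f], the reflection in e - f exchanges [e] and [f]; otherwise an Eichler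
    transvection along [f] moves the odd pairing with [proj d] into (b, e). *)
Lemma orbit_even n b x y : (2 %| x)%Z -> (2 %| y)%Z -> primitive (vec b x y) ->
  bform A (vec b x y) (vec b x y) = 2 * (2 * n) ->
  same_orbit A (vec b x y) (vec (n *: e + f) 0 0).
Proof.
move=> x2 y2 pr nm; have [/dvdzP[x' xE] /dvdzP[y' yE]] := (x2, y2).
have reduce b' : same_orbit A (vec b x y) (vec b' x y) -> ~~ (2 %| bform G b' e)%Z ->
    same_orbit A (vec b x y) (vec (n *: e + f) 0 0).
  move=> o oe; apply: (same_orbit_trans o).
  have pr' := same_orbit_primitive o pr; have nm' := same_orbit_norm o.
  move: pr' nm'; rewrite nm xE yE ![_ * 2]mulrC; exact: orbit_even_aux.
have [be|be] := boolP (2 %| bform G b e)%Z; last exact: reduce (same_orbit_refl _ _) be.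
have [bf|bf] := boolP (2 %| bform G b f)%Z; last first.
  have cc : bform G (e - f) (e - f) = - 2.
    by rewrite bformDl !bformDr !bformNl !bformNr ee ff ef fe; ring.
  apply: (reduce _ (orbit_reflection Gs dG b x y cc)).
  rewrite bformDl bformZl bformDl bformNl bformDr bformNr ee fe.
  by move: bf; clear; lia.
have [/forallP bd|/forallPn[i bi]] := boolP [forall i, (2 %| bform G b (delta_mx ord0 i))%Z].
  by have := primitive_dvd pr x2 y2 bd; lia.
set d := delta_mx _ _ in bi; have [k kE] := even_half (proj d).
have pe : bform G f (proj d) = 0 by rewrite bformC // proj_f.
apply: (reduce _ (orbit_eichler Gs dG b x y ff pe kE)).
rewrite bformDl bformDl bformNl !bformZl proj_e fe.
move: bi; rewrite (projE d); move: (bform G b (proj d)) => u.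
move: be bf => /dvdzP[b1 ->] /dvdzP[b2 ->]; apply: contra.
rewrite (_ : _ - _ = b1 * 2 - k * b2 * 2 - u); last by ring.
move=> h; have hu : (2 %| u)%Z.
  rewrite (_ : u = b1 * 2 - k * b2 * 2 - (b1 * 2 - k * b2 * 2 - u)); last by ring.
  by rewrite rpredB // rpredB ?dvdz_mull.
by rewrite !rpredD ?dvdz_mull ?dvdz_mull.
Qed.

End Orbits.

(** * Counting the orbits *)

Lemma primitive_witness n (v : 'rV[int]_n) (phi : 'rV[int]_n -> int) :
  (forall k w, phi (k *: w) = k * phi w) -> phi v = 1 -> primitive v.
Proof.
move=> phiZ v1; split.
  by apply: contra_eq_neq v1 => ->; rewrite -(scale0r 0) phiZ mul0r eq_sym oner_eq0.
move=> k w vE; have : (k %| phi v)%Z by rewrite vE phiZ dvdz_mulr.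
by rewrite v1 dvdz1; lia.
Qed.

Theorem theorem1 (r : nat) (G : 'M[int]_r) (n : int) :
  is_lattice G -> even_lattice G -> unimodular G -> indefinite G ->
  let A := osum (rescale 2 G) U_gram in
  num_classes (fun w : 'rV[int]_(r + 2) => primitive w /\ bform A w w = 2 * n)
              (same_orbit A)
              (if (2 %| n)%Z then 2%N else 1%N).
Proof.
move=> [Gs dG] Gev Gu Gi A.
have [e [f [ee ff ef]]] := hyperbolic_pair Gs Gev Gu Gi.
have fe : bform G f e = 1 by rewrite bformC.
have dG0 : \det G != 0 by case: Gu => ->; rewrite ?oppr_eq0 oner_eq0.
pose u : 'rV[int]_(r + 2) := vec 0 1 n.
have Su : primitive u /\ bform A u u = 2 * n.
  split; last by rewrite bform_vec bform0l; ring.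
  apply: (@primitive_witness _ _ (fun w => w 0 (rshift r 0))).
    by move=> k w; rewrite mxE.
  by rewrite /u /vec row_mxEr mxE.
have orb_odd b x y : ~~ ((2 %| x) && (2 %| y))%Z -> primitive (vec b x y) ->
    bform A (vec b x y) (vec b x y) = 2 * n -> same_orbit A u (vec b x y).
  rewrite negb_and => /orP[ox|oy] pr nm; apply: same_orbit_sym.
    exact: (orbit_odd Gs Gev Gu ee ff ef).
  have o := orbit_swap Gs dG0 b x y; apply: (same_orbit_trans o).
  apply: (orbit_odd Gs Gev Gu ee ff ef) => //; first exact: same_orbit_primitive o pr.
  by rewrite (same_orbit_norm o).
(* n = (b, b) + xy with (b, b) even, so for odd n one of x, y is odd and the second orbit cannot
   occur. *)
have n_even b x y : bform A (vec b x y) (vec b x y) = 2 * n -> (2 %| x)%Z -> (2 %| y)%Z ->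
  (2 %| n)%Z.
  rewrite bform_vec; have /dvdzP[k ->] := Gev b.
  move=> nE /dvdzP[x' xE] /dvdzP[y' yE]; apply/dvdzP; exists (k + 2 * x' * y').
  by move: nE; rewrite xE yE; lia.
case: ifP => n2; last first.
  exists (fun=> u); split=> //; split=> [i j _|w [pr nm]]; first by rewrite !ord1.
  exists ord0; move: pr nm; rewrite [w]vecE => pr nm; apply: orb_odd => //.
  by apply/negP => /andP[x2 y2]; move: (n_even _ _ _ nm x2 y2); rewrite n2.
have /dvdzP[h hE] := n2.
pose v : 'rV[int]_(r + 2) := vec (h *: e + f) 0 0.
have Sv : primitive v /\ bform A v v = 2 * n.
  split; last by rewrite bform_vec bformDl !bformDr !bformZl !bformZr ee ff ef fe hE; ring.
  apply: (@primitive_witness _ _ (fun w => bform G (lsubmx w) e)).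
    by move=> k w; rewrite linearZ bformZl.
  by rewrite /v /vec row_mxKl bformDl bformZl ee fe; ring.
have uv : ~ same_orbit A v u.
  move/same_orbit_even=> h2; have /h2/(_ (vec 0 0 1)) : forall w, (2 %| bform A v w)%Z.
    by move=> w; rewrite [w]vecE bform_vec !mul0r !addr0 dvdz_mulr.
  by rewrite bform_vec bform0l !mulr0 add0r addr0 mulr1.
exists (fun i : 'I_2 => if i == 0 then u else v); split; first by move=> i; case: ifP.
split=> [i j|w [pr nm]].
  have [->|->] : i = 0 \/ i = 1 by case: (i) => [[|[]]] // hi; [left|right]; apply/val_inj.
    have [->|->] : j = 0 \/ j = 1 by case: (j) => [[|[]]] // hj; [left|right]; apply/val_inj.
      by [].
    by move/same_orbit_sym.
  have [->|->] : j = 0 \/ j = 1 by case: (j) => [[|[]]] // hj; [left|right]; apply/val_inj.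
    by [].
  by [].
move: pr nm; rewrite [w]vecE;
  move: (lsubmx w) (w 0 (rshift r 0)) (w 0 (rshift r 1)) => b x y pr nm.
have [/andP[x2 y2]|xy] := boolP ((2 %| x) && (2 %| y))%Z; last by exists 0;
  exact: (orb_odd _ _ _ xy pr nm).
exists 1; apply: same_orbit_sym; apply: (orbit_even Gs Gev Gu ee ff ef) => //.
by rewrite nm hE; ring.
Qed.
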